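(* Let $\mathcal{C}$ be a symmetric monoidal category. There is an equivalence between the category $\mathsf{SplitExt}(\mathsf{Hopf}_{\mathcal{C}})$ of split extensions of (non-associative) Hopf algebras in $\mathcal{C}$ and the category $\mathsf{Act}(\mathsf{Hopf}_{\mathcal{C}})$ of actions of (non-associative) Hopf algebras in $\mathcal{C}$.
   Context: $(\mathcal{C},\otimes,I,\sigma)$ is a symmetric monoidal category (associativity and unit isomorphisms are suppressed); $f\cdot g$ denotes composition ($g$ first) and $1_X$ the identity of $X$. An algebra is an object $A$ with morphisms $m\colon A\otimes A\to A$, $u_A\colon I\to A$ with $m\cdot(u_A\otimes 1_A)=1_A=m\cdot(1_A\otimes u_A)$; associativity is NOT required. Algebra morphisms preserve $m$ and $u$. A coalgebra $(C,\Delta,\epsilon_C)$ is coassociative and counital; coalgebra morphisms preserve $\Delta$ and $\epsilon$. A bialgebra is $(B,m,u_B,\Delta,\epsilon_B)$, with $(B,m,u_B)$ an algebra, $(B,\Delta,\epsilon_B)$ a coalgebra, and $\Delta\cdot m=(m\otimes m)\cdot(1_B\otimes\sigma_{B,B}\otimes 1_B)\cdot(\Delta\otimes\Delta)$, $\Delta\cdot u_B=u_B\otimes u_B$, $\epsilon_B\cdot m=\epsilon_B\otimes\epsilon_B$, $\epsilon_B\cdot u_B=1_I$. A bialgebra morphism is a morphism of algebras and of coalgebras. A Hopf algebra (meaning non-associative Hopf algebra) is a bialgebra $A$ with morphisms $S_L,S_R\colon A\to A$ (left and right antipode), both antihomomorphisms of algebras ($S\cdot m=m\cdot\sigma_{A,A}\cdot(S\otimes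 S)$, $S\cdot u_A=u_A$) and of coalgebras ($\Delta\cdot S=(S\otimes S)\cdot\sigma_{A,A}\cdot\Delta$, $\epsilon_A\cdot S=\epsilon_A$), such that $m\cdot(S_L\otimes 1_A)\cdot\Delta=u_A\cdot\epsilon_A=m\cdot(1_A\otimes S_R)\cdot\Delta$. A morphism of Hopf algebras is a bialgebra morphism preserving both antipodes. Action of Hopf algebras: for Hopf algebras $B,X$, a morphism $\triangleright\colon B\otimes X\to X$ in $\mathcal{C}$ such that $\triangleright\cdot(u_B\otimes 1_X)=1_X$; $\triangleright\cdot(1_B\otimes u_X)=u_X\cdot\epsilon_B$; $(1_B\otimes\triangleright)\cdot(\Delta\otimes 1_X)=(1_B\otimes\triangleright)\cdot(\sigma_{B,B}\otimes 1_X)\cdot(\Delta\otimes 1_X)$; $\epsilon_X\cdot\triangleright=\epsilon_B\otimes\epsilon_X$; $\Delta\cdot\triangleright=(\triangleright\otimes\triangleright)\cdot(1_B\otimes\sigma_{B,X}\otimes 1_X)\cdot(\Delta\otimes\Delta)$; $\triangleright\cdot(1_B\otimes\triangleright)=\triangleright\cdot(m\otimes 1_X)$; $\triangleright\cdot(1_B\otimes m)=m\cdot(\triangleright\otimes\triangleright)\cdot(1_B\otimes\sigma_{B,X}\otimes 1_X)\cdot(\Delta\otimes 1_X\otimes 1_X)$; $\triangleright\cdot(1_B\otimes S_L)=S_L\cdot\triangleright$; $\triangleright\cdot(S_R\otimes S_R)\cdot(1_B\otimes\triangleright)\cdot(\Delta\otimes 1_X)=\epsilon_B\otimes S_R$.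 A morphism from $\triangleright\colon B\otimes X\to X$ to $\triangleright'\colon B'\otimes X'\to X'$ is a pair of Hopf algebra morphisms $g\colon B\to B'$, $v\colon X\to X'$ with $v\cdot\triangleright=\triangleright'\cdot(g\otimes v)$. These form $\mathsf{Act}(\mathsf{Hopf}_{\mathcal{C}})$. Split extension of Hopf algebras: Hopf algebras $X,A,B$, Hopf algebra morphisms $\kappa\colon X\to A$, $\alpha\colon A\to B$, $e\colon B\to A$ and a morphism $\lambda\colon A\to X$ in $\mathcal{C}$ such that (1') $\lambda\cdot\kappa=1_X$, $\alpha\cdot e=1_B$; (2') $\lambda\cdot e=u_X\cdot\epsilon_B$, $\alpha\cdot\kappa=u_B\cdot\epsilon_X$; (3') $m\cdot((\kappa\cdot\lambda)\otimes(e\cdot\alpha))\cdot\Delta=1_A$; (4') $\lambda\cdot m\cdot(\kappa\otimes e)=1_X\otimes\epsilon_B$; (5') $(1_B\otimes\lambda)\cdot(1_B\otimes m)\cdot(1_B\otimes e\otimes\kappa)\cdot(\Delta\otimes 1_X)=(1_B\otimes\lambda)\cdot(1_B\otimes m)\cdot(1_B\otimes e\otimes\kappa)\cdot(\sigma_{B,B}\otimes 1_X)\cdot(\Delta\otimes 1_X)$; (6') $m\cdot(m\otimes 1_A)\cdot(\kappa\otimes e\otimes 1_A)=m\cdot(1_A\otimes m)\cdot(\kappa\otimes e\otimes 1_A)$; (7') $m\cdot(m\otimes 1_A)\cdot(\kappa\otimes 1_A\otimes e)=m\cdot(1_A\otimes m)\cdot(\kappa\otimes 1_A\otimes e)$;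 (8') $m\cdot(m\otimes 1_A)\cdot(1_A\otimes\kappa\otimes e)=m\cdot(1_A\otimes m)\cdot(1_A\otimes\kappa\otimes e)$; (9') $m\cdot(m\otimes 1_A)\cdot(e\otimes 1_A\otimes\kappa)=m\cdot(1_A\otimes m)\cdot(e\otimes 1_A\otimes\kappa)$; (10') $S_L\cdot\lambda\cdot m\cdot(e\otimes\kappa)=\lambda\cdot m\cdot(e\otimes\kappa)\cdot(1_B\otimes S_L)$; (11') $\epsilon_B\otimes S_R=\lambda\cdot m\cdot(e\otimes\kappa)\cdot(S_R\otimes S_R)\cdot(1_B\otimes\lambda)\cdot(1_B\otimes m)\cdot(1_B\otimes e\otimes\kappa)\cdot(\Delta\otimes 1_X)$; (12') $\lambda$ is a morphism of coalgebras preserving the unit. A morphism from $(X,A,B,\kappa,\alpha,e,\lambda)$ to $(X',A',B',\kappa',\alpha',e',\lambda')$ is a triple $(g,v,p)$ of Hopf algebra morphisms $g\colon B\to B'$, $v\colon X\to X'$, $p\colon A\to A'$ with $p\cdot\kappa=\kappa'\cdot v$, $p\cdot e=e'\cdot g$, $\alpha'\cdot p=g\cdot\alpha$, $\lambda'\cdot p=v\cdot\lambda$. These form $\mathsf{SplitExt}(\mathsf{Hopf}_{\mathcal{C}})$. *)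

(* Defs.v *)
From Stdlib Require Import ProofIrrelevance.

Set Implicit Arguments.
Unset Strict Implicit.
Unset Printing Implicit Defensive.

Declare Scope ob_scope.
Declare Scope hom_scope.
Delimit Scope ob_scope with ob.
Delimit Scope hom_scope with hom.

Reserved Notation "g ⋅ f" (at level 40, left associativity).
Reserved Notation "x ⊗ y" (at level 30, right associativity).

(** * Categories, functors, equivalences *)

Record Category := {
  Ob :> Type;
  Hom : Ob -> Ob -> Type;
  idm : forall X, Hom X X;
  comp : forall X Y Z, Hom Y Z -> Hom X Y -> Hom X Z;
  comp_assoc : forall W X Y Z (h : Hom Y Z) (g : Hom X Y) (f : Hom W X),
    comp h (comp g f) = comp (comp h g) f;
  comp_idl : forall X Y (f : Hom X Y), comp (idm Y) f = f;
  comp_idr : forall X Y (f : Hom X Y), comp f (idm X) = f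
}.

Bind Scope ob_scope with Ob.
Bind Scope hom_scope with Hom.
Arguments Hom {_} _%_ob _%_ob.
Arguments idm {_} X%_ob.
Arguments comp {_ X Y Z} g%_hom f%_hom.

(* g ⋅ f applies f first. *)
Notation "g ⋅ f" := (comp g f) : hom_scope.
Open Scope ob_scope.
Open Scope hom_scope.

Record Functor (C D : Category) := {
  fob :> C -> D;
  fmap : forall X Y : C, Hom X Y -> Hom (fob X) (fob Y);
  fmap_id : forall X : C, fmap (idm X) = idm (fob X);
  fmap_comp : forall (X Y Z : C) (g : Hom Y Z) (f : Hom X Y),
    fmap (g ⋅ f) = fmap g ⋅ fmap f
}.
Arguments fmap {C D} F {X Y} f : rename.

Definition id_functor (C : Category) : Functor C C := {|
  fob := fun X => X;
  fmap := fun _ _ f => f;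
  fmap_id := fun _ => eq_refl;
  fmap_comp := fun _ _ _ _ _ => eq_refl
|}.

Definition comp_functor (C D E : Category) (G : Functor D E) (F : Functor C D) :
  Functor C E.
Proof.
refine {| fob := fun X => G (F X); fmap := fun X Y f => fmap G (fmap F f) |}.
- intros X. rewrite fmap_id. apply fmap_id.
- intros X Y Z g f. rewrite fmap_comp. apply fmap_comp.
Defined.

Record NatIso (C D : Category) (F G : Functor C D) := {
  ni_hom : forall X : C, Hom (F X) (G X);
  ni_inv : forall X : C, Hom (G X) (F X);
  ni_natural : forall (X Y : C) (f : Hom X Y),
    ni_hom Y ⋅ fmap F f = fmap G f ⋅ ni_hom X;
  ni_homK : forall X : C, ni_inv X ⋅ ni_hom X = idm (F X);
  ni_invK : forall X : C, ni_hom X ⋅ ni_inv X = idm (G X)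
}.

Definition equivalent_categories (C D : Category) : Prop :=
  exists (F : Functor C D) (G : Functor D C),
    inhabited (NatIso (comp_functor G F) (id_functor C)) /\
    inhabited (NatIso (comp_functor F G) (id_functor D)).

(** * Symmetric monoidal categories *)

Record MonoidalCategory := {
  mcat :> Category;
  munit : mcat;
  tens : mcat -> mcat -> mcat;
  tensm : forall W X Y Z : mcat,
    Hom W X -> Hom Y Z -> Hom (tens W Y) (tens X Z);
  tensm_id : forall X Y : mcat, tensm (idm X) (idm Y) = idm (tens X Y);
  tensm_comp : forall (X X' X'' Y Y' Y'' : mcat)
      (f' : Hom X' X'') (f : Hom X X') (g' : Hom Y' Y'') (g : Hom Y Y'),
    tensm (f' ⋅ f) (g' ⋅ g) = tensm f' g' ⋅ tensm f g;
  assoc : forall X Y Z : mcat, Hom (tens (tens X Y) Z) (tens X (tens Y Z));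
  assoc_inv : forall X Y Z : mcat, Hom (tens X (tens Y Z)) (tens (tens X Y) Z);
  lunit : forall X : mcat, Hom (tens munit X) X;
  lunit_inv : forall X : mcat, Hom X (tens munit X);
  runit : forall X : mcat, Hom (tens X munit) X;
  runit_inv : forall X : mcat, Hom X (tens X munit);
  assocK : forall X Y Z, assoc_inv X Y Z ⋅ assoc X Y Z = idm _;
  assoc_invK : forall X Y Z, assoc X Y Z ⋅ assoc_inv X Y Z = idm _;
  lunitK : forall X, lunit_inv X ⋅ lunit X = idm _;
  lunit_invK : forall X, lunit X ⋅ lunit_inv X = idm _;
  runitK : forall X, runit_inv X ⋅ runit X = idm _;
  runit_invK : forall X, runit X ⋅ runit_inv X = idm _;
  assoc_natural : forall (X X' Y Y' Z Z' : mcat)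
      (f : Hom X X') (g : Hom Y Y') (h : Hom Z Z'),
    assoc X' Y' Z' ⋅ tensm (tensm f g) h = tensm f (tensm g h) ⋅ assoc X Y Z;
  lunit_natural : forall (X Y : mcat) (f : Hom X Y),
    lunit Y ⋅ tensm (idm munit) f = f ⋅ lunit X;
  runit_natural : forall (X Y : mcat) (f : Hom X Y),
    runit Y ⋅ tensm f (idm munit) = f ⋅ runit X;
  pentagon : forall W X Y Z : mcat,
    tensm (idm W) (assoc X Y Z) ⋅ assoc W (tens X Y) Z
      ⋅ tensm (assoc W X Y) (idm Z)
    = assoc W X (tens Y Z) ⋅ assoc (tens W X) Y Z;
  triangle : forall X Y : mcat,
    tensm (idm X) (lunit Y) ⋅ assoc X munit Y = tensm (runit X) (idm Y)
}.
Arguments munit C : rename.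
Arguments tens {C} X%_ob Y%_ob : rename.
Arguments tensm {C W X Y Z} f%_hom g%_hom : rename.
Arguments assoc {C} X%_ob Y%_ob Z%_ob : rename.
Arguments assoc_inv {C} X%_ob Y%_ob Z%_ob : rename.
Arguments lunit {C} X%_ob : rename.
Arguments lunit_inv {C} X%_ob : rename.
Arguments runit {C} X%_ob : rename.
Arguments runit_inv {C} X%_ob : rename.

Notation "X ⊗ Y" := (tens X Y) : ob_scope.
Notation "f ⊗ g" := (tensm f g) : hom_scope.

Record SymMonCategory := {
  smcat :> MonoidalCategory;
  sym : forall X Y : smcat, Hom (X ⊗ Y) (Y ⊗ X);
  sym_natural : forall (X X' Y Y' : smcat) (f : Hom X X') (g : Hom Y Y'),
    sym X' Y' ⋅ (f ⊗ g) = (g ⊗ f) ⋅ sym X Y;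
  symK : forall X Y : smcat, sym Y X ⋅ sym X Y = idm (X ⊗ Y);
  hexagon : forall X Y Z : smcat,
    assoc Y Z X ⋅ sym X (Y ⊗ Z) ⋅ assoc X Y Z
    = (idm Y ⊗ sym X Z) ⋅ assoc Y X Z ⋅ (sym X Y ⊗ idm Z)
}.
Arguments sym {C} X%_ob Y%_ob : rename.

(* 1_W ⊗ σ_{X,Y} ⊗ 1_Z with the associativity isomorphisms made explicit. *)
Definition midswap (C : SymMonCategory) (W X Y Z : C) :
  Hom ((W ⊗ X) ⊗ (Y ⊗ Z)) ((W ⊗ Y) ⊗ (X ⊗ Z)) :=
  assoc_inv W Y (X ⊗ Z)
  ⋅ (idm W ⊗ (assoc Y X Z ⋅ (sym X Y ⊗ idm Z) ⋅ assoc_inv X Y Z))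
  ⋅ assoc W X (Y ⊗ Z).
Arguments midswap {C} W%_ob X%_ob Y%_ob Z%_ob.

(** * Non-associative Hopf algebras *)

(* Associativity of the multiplication is deliberately not required. *)
Record is_algebra (C : SymMonCategory) (A : C)
    (m : Hom (A ⊗ A) A) (u : Hom (munit C) A) : Prop := {
  alg_unitl : m ⋅ (u ⊗ idm A) = lunit A;
  alg_unitr : m ⋅ (idm A ⊗ u) = runit A
}.

Record is_coalgebra (C : SymMonCategory) (A : C)
    (d : Hom A (A ⊗ A)) (c : Hom A (munit C)) : Prop := {
  coalg_coassoc : assoc A A A ⋅ (d ⊗ idm A) ⋅ d = (idm A ⊗ d) ⋅ d;
  coalg_counitl : lunit A ⋅ (c ⊗ idm A) ⋅ d = idm A;
  coalg_counitr : runit A ⋅ (idm A ⊗ c) ⋅ d = idm A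
}.

Record Bialgebra (C : SymMonCategory) := {
  bialg_ob :> C;
  mul : Hom (bialg_ob ⊗ bialg_ob) bialg_ob;
  unt : Hom (munit C) bialg_ob;
  comul : Hom bialg_ob (bialg_ob ⊗ bialg_ob);
  counit : Hom bialg_ob (munit C);
  bialg_algebra : is_algebra mul unt;
  bialg_coalgebra : is_coalgebra comul counit;
  comul_mul : comul ⋅ mul
    = (mul ⊗ mul) ⋅ midswap bialg_ob bialg_ob bialg_ob bialg_ob
      ⋅ (comul ⊗ comul);
  comul_unt : comul ⋅ unt = (unt ⊗ unt) ⋅ lunit_inv (munit C);
  counit_mul : counit ⋅ mul = lunit (munit C) ⋅ (counit ⊗ counit);
  counit_unt : counit ⋅ unt = idm (munit C)
}.
Arguments mul {C} A : rename.
Arguments unt {C} A : rename.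
Arguments comul {C} A : rename.
Arguments counit {C} A : rename.

Section Morphisms.
Context (C : SymMonCategory).
Implicit Types A B : Bialgebra C.

Record is_algebra_hom A B (f : Hom A B) : Prop := {
  hom_mul : f ⋅ mul A = mul B ⋅ (f ⊗ f);
  hom_unt : f ⋅ unt A = unt B
}.

Record is_coalgebra_hom A B (f : Hom A B) : Prop := {
  hom_comul : comul B ⋅ f = (f ⊗ f) ⋅ comul A;
  hom_counit : counit B ⋅ f = counit A
}.

Record is_algebra_antihom A (S : Hom A A) : Prop := {
  antihom_mul : S ⋅ mul A = mul A ⋅ sym A A ⋅ (S ⊗ S);
  antihom_unt : S ⋅ unt A = unt A
}.

Record is_coalgebra_antihom A (S : Hom A A) : Prop := {
  antihom_comul : comul A ⋅ S = (S ⊗ S) ⋅ sym A A ⋅ comul A;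
  antihom_counit : counit A ⋅ S = counit A
}.
End Morphisms.

Record HopfAlgebra (C : SymMonCategory) := {
  hopf_bialg :> Bialgebra C;
  SL : Hom hopf_bialg hopf_bialg;
  SR : Hom hopf_bialg hopf_bialg;
  SL_algebra : is_algebra_antihom SL;
  SL_coalgebra : is_coalgebra_antihom SL;
  SR_algebra : is_algebra_antihom SR;
  SR_coalgebra : is_coalgebra_antihom SR;
  SL_antipode : mul hopf_bialg ⋅ (SL ⊗ idm hopf_bialg) ⋅ comul hopf_bialg
    = unt hopf_bialg ⋅ counit hopf_bialg;
  SR_antipode : mul hopf_bialg ⋅ (idm hopf_bialg ⊗ SR) ⋅ comul hopf_bialg
    = unt hopf_bialg ⋅ counit hopf_bialg
}.
Arguments SL {C} A : rename.
Arguments SR {C} A : rename.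

Record is_hopf_hom (C : SymMonCategory) (A B : HopfAlgebra C) (f : Hom A B) :
    Prop := {
  hopf_hom_algebra : is_algebra_hom f;
  hopf_hom_coalgebra : is_coalgebra_hom f;
  hopf_hom_SL : f ⋅ SL A = SL B ⋅ f;
  hopf_hom_SR : f ⋅ SR A = SR B ⋅ f
}.

Record HopfHom (C : SymMonCategory) (A B : HopfAlgebra C) := {
  hopf_hom :> Hom A B;
  hopf_homP : is_hopf_hom hopf_hom
}.

Lemma hopf_hom_eq (C : SymMonCategory) (A B : HopfAlgebra C)
  (f g : HopfHom A B) : hopf_hom f = hopf_hom g -> f = g.
Proof.
destruct f as [f Pf], g as [g Pg]; simpl; intros E; subst g.
f_equal; apply proof_irrelevance.
Qed.

Lemma is_hopf_hom_id (C : SymMonCategory) (A : HopfAlgebra C) :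
  is_hopf_hom (idm A).
Proof.
repeat split; rewrite ?tensm_id, ?comp_idl, ?comp_idr; reflexivity.
Qed.

Lemma is_hopf_hom_comp (C : SymMonCategory) (A B D : HopfAlgebra C)
  (g : Hom B D) (f : Hom A B) :
  is_hopf_hom g -> is_hopf_hom f -> is_hopf_hom (g ⋅ f).
Proof.
intros [[g1 g2] [g3 g4] g5 g6] [[f1 f2] [f3 f4] f5 f6].
constructor; [constructor | constructor | |].
- rewrite <- comp_assoc, f1, comp_assoc, g1, <- comp_assoc, <- tensm_comp.
  reflexivity.
- rewrite <- comp_assoc, f2; exact g2.
- rewrite comp_assoc, g3, <- comp_assoc, f3, comp_assoc, <- tensm_comp.
  reflexivity.
- rewrite comp_assoc, g4; exact f4.
- rewrite <- comp_assoc, f5, comp_assoc, g5, comp_assoc; reflexivity.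
- rewrite <- comp_assoc, f6, comp_assoc, g6, comp_assoc; reflexivity.
Qed.

Definition hopf_id (C : SymMonCategory) (A : HopfAlgebra C) : HopfHom A A :=
  Build_HopfHom (is_hopf_hom_id A).

Definition hopf_comp (C : SymMonCategory) (A B D : HopfAlgebra C)
  (g : HopfHom B D) (f : HopfHom A B) : HopfHom A D :=
  Build_HopfHom (is_hopf_hom_comp (hopf_homP g) (hopf_homP f)).

(** * Actions *)

Section IsAction.
Context (C : SymMonCategory) (B X : HopfAlgebra C).

Record is_action (act : Hom (B ⊗ X) X) : Prop := {
  act_unt : act ⋅ (unt B ⊗ idm X) = lunit X;
  act_on_unt : act ⋅ (idm B ⊗ unt X) = unt X ⋅ counit B ⋅ runit B;
  act_sym :
    (idm B ⊗ act) ⋅ assoc B B X ⋅ (comul B ⊗ idm X)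
    = (idm B ⊗ act) ⋅ assoc B B X ⋅ (sym B B ⊗ idm X) ⋅ (comul B ⊗ idm X);
  act_counit :
    counit X ⋅ act = lunit (munit C) ⋅ (counit B ⊗ counit X);
  act_comul :
    comul X ⋅ act = (act ⊗ act) ⋅ midswap B B X X ⋅ (comul B ⊗ comul X);
  act_mul :
    act ⋅ (idm B ⊗ act) ⋅ assoc B B X = act ⋅ (mul B ⊗ idm X);
  act_on_mul :
    act ⋅ (idm B ⊗ mul X)
    = mul X ⋅ (act ⊗ act) ⋅ midswap B B X X
      ⋅ (comul B ⊗ (idm X ⊗ idm X));
  act_SL : act ⋅ (idm B ⊗ SL X) = SL X ⋅ act;
  act_SR :
    act ⋅ (SR B ⊗ SR X) ⋅ (idm B ⊗ act) ⋅ assoc B B X ⋅ (comul B ⊗ idm X)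
    = lunit X ⋅ (counit B ⊗ SR X)
}.
End IsAction.

Record Action (C : SymMonCategory) := {
  action_B : HopfAlgebra C;
  action_X : HopfAlgebra C;
  action_map : Hom (action_B ⊗ action_X) action_X;
  actionP : is_action action_map
}.

Record ActionHom (C : SymMonCategory) (a a' : Action C) := {
  ah_g : HopfHom (action_B a) (action_B a');
  ah_v : HopfHom (action_X a) (action_X a');
  ah_comm : ah_v ⋅ action_map a = action_map a' ⋅ (ah_g ⊗ ah_v)
}.

Lemma action_hom_eq (C : SymMonCategory) (a a' : Action C)
  (f f' : ActionHom a a') :
  hopf_hom (ah_g f) = hopf_hom (ah_g f') ->
  hopf_hom (ah_v f) = hopf_hom (ah_v f') -> f = f'.
Proof.
destruct f as [g v c], f' as [g' v' c']; simpl; intros Eg Ev.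
apply hopf_hom_eq in Eg; apply hopf_hom_eq in Ev; subst g' v'.
f_equal; apply proof_irrelevance.
Qed.

Definition action_id (C : SymMonCategory) (a : Action C) : ActionHom a a.
Proof.
refine {| ah_g := hopf_id _; ah_v := hopf_id _ |}.
abstract (simpl; rewrite tensm_id, comp_idl, comp_idr; reflexivity).
Defined.

Definition action_comp (C : SymMonCategory) (a b c : Action C)
  (h : ActionHom b c) (f : ActionHom a b) : ActionHom a c.
Proof.
refine {| ah_g := hopf_comp (ah_g h) (ah_g f);
          ah_v := hopf_comp (ah_v h) (ah_v f) |}.
abstract (simpl; rewrite <- comp_assoc, (ah_comm f), comp_assoc, (ah_comm h),
  <- comp_assoc, <- tensm_comp; reflexivity).
Defined.

Definition Act (C : SymMonCategory) : Category.
Proof.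
refine {| Ob := Action C; Hom := @ActionHom C;
          idm := @action_id C; comp := @action_comp C |}.
- abstract (intros; apply action_hom_eq; apply comp_assoc).
- abstract (intros; apply action_hom_eq; apply comp_idl).
- abstract (intros; apply action_hom_eq; apply comp_idr).
Defined.

(** * Split extensions *)

Section IsSplitExtension.
Context (C : SymMonCategory) (X A B : HopfAlgebra C).

Record is_split_extension (kappa : HopfHom X A) (alpha : HopfHom A B)
    (e : HopfHom B A) (lam : Hom A X) : Prop := {
  lam_kappa : lam ⋅ kappa = idm X;
  alpha_e : alpha ⋅ e = idm B;
  lam_e : lam ⋅ e = unt X ⋅ counit B;
  alpha_kappa : alpha ⋅ kappa = unt B ⋅ counit X;
  se_decomp : mul A ⋅ ((kappa ⋅ lam) ⊗ (e ⋅ alpha)) ⋅ comul A = idm A;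
  se_lam : lam ⋅ mul A ⋅ (kappa ⊗ e) = runit X ⋅ (idm X ⊗ counit B);
  se_sym :
    (idm B ⊗ lam) ⋅ (idm B ⊗ mul A) ⋅ (idm B ⊗ (e ⊗ kappa)) ⋅ assoc B B X
      ⋅ (comul B ⊗ idm X)
    = (idm B ⊗ lam) ⋅ (idm B ⊗ mul A) ⋅ (idm B ⊗ (e ⊗ kappa)) ⋅ assoc B B X
      ⋅ (sym B B ⊗ idm X) ⋅ (comul B ⊗ idm X);
  se_assoc_ke :
    mul A ⋅ (mul A ⊗ idm A) ⋅ ((kappa ⊗ e) ⊗ idm A)
    = mul A ⋅ (idm A ⊗ mul A) ⋅ assoc A A A ⋅ ((kappa ⊗ e) ⊗ idm A);
  se_assoc_k_e :
    mul A ⋅ (mul A ⊗ idm A) ⋅ ((kappa ⊗ idm A) ⊗ e)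
    = mul A ⋅ (idm A ⊗ mul A) ⋅ assoc A A A ⋅ ((kappa ⊗ idm A) ⊗ e);
  se_assoc__ke :
    mul A ⋅ (mul A ⊗ idm A) ⋅ ((idm A ⊗ kappa) ⊗ e)
    = mul A ⋅ (idm A ⊗ mul A) ⋅ assoc A A A ⋅ ((idm A ⊗ kappa) ⊗ e);
  se_assoc_e_k :
    mul A ⋅ (mul A ⊗ idm A) ⋅ ((e ⊗ idm A) ⊗ kappa)
    = mul A ⋅ (idm A ⊗ mul A) ⋅ assoc A A A ⋅ ((e ⊗ idm A) ⊗ kappa);
  se_SL :
    SL X ⋅ lam ⋅ mul A ⋅ (e ⊗ kappa)
    = lam ⋅ mul A ⋅ (e ⊗ kappa) ⋅ (idm B ⊗ SL X);
  se_SR :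
    lunit X ⋅ (counit B ⊗ SR X)
    = lam ⋅ mul A ⋅ (e ⊗ kappa) ⋅ (SR B ⊗ SR X)
      ⋅ (idm B ⊗ lam) ⋅ (idm B ⊗ mul A) ⋅ (idm B ⊗ (e ⊗ kappa)) ⋅ assoc B B X
      ⋅ (comul B ⊗ idm X);
  lam_coalgebra : is_coalgebra_hom lam;
  lam_unt : lam ⋅ unt A = unt X
}.
End IsSplitExtension.

Record SplitExtension (C : SymMonCategory) := {
  se_X : HopfAlgebra C;
  se_A : HopfAlgebra C;
  se_B : HopfAlgebra C;
  se_kappa : HopfHom se_X se_A;
  se_alpha : HopfHom se_A se_B;
  se_e : HopfHom se_B se_A;
  se_lambda : Hom se_A se_X;
  split_extensionP : is_split_extension se_kappa se_alpha se_e se_lambda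
}.

Record SplitExtHom (C : SymMonCategory) (E E' : SplitExtension C) := {
  sh_g : HopfHom (se_B E) (se_B E');
  sh_v : HopfHom (se_X E) (se_X E');
  sh_p : HopfHom (se_A E) (se_A E');
  sh_kappa : sh_p ⋅ se_kappa E = se_kappa E' ⋅ sh_v;
  sh_e : sh_p ⋅ se_e E = se_e E' ⋅ sh_g;
  sh_alpha : se_alpha E' ⋅ sh_p = sh_g ⋅ se_alpha E;
  sh_lambda : se_lambda E' ⋅ sh_p = sh_v ⋅ se_lambda E
}.

Lemma split_ext_hom_eq (C : SymMonCategory) (E E' : SplitExtension C)
  (f f' : SplitExtHom E E') :
  hopf_hom (sh_g f) = hopf_hom (sh_g f') ->
  hopf_hom (sh_v f) = hopf_hom (sh_v f') ->
  hopf_hom (sh_p f) = hopf_hom (sh_p f') -> f = f'.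
Proof.
destruct f as [g v p c1 c2 c3 c4], f' as [g' v' p' c1' c2' c3' c4']; simpl.
intros Eg Ev Ep.
apply hopf_hom_eq in Eg; apply hopf_hom_eq in Ev; apply hopf_hom_eq in Ep.
subst g' v' p'.
f_equal; apply proof_irrelevance.
Qed.

Definition split_ext_id (C : SymMonCategory) (E : SplitExtension C) :
  SplitExtHom E E.
Proof.
refine {| sh_g := hopf_id _; sh_v := hopf_id _; sh_p := hopf_id _ |};
  abstract (simpl; rewrite comp_idl, comp_idr; reflexivity).
Defined.

Lemma square_paste (C : Category) (X X' X'' Y Y' Y'' : C)
  (a : Hom X Y) (a' : Hom X' Y') (a'' : Hom X'' Y'')
  (f : Hom X X') (f' : Hom X' X'') (g : Hom Y Y') (g' : Hom Y' Y'') :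
  a' ⋅ f = g ⋅ a -> a'' ⋅ f' = g' ⋅ a' -> a'' ⋅ (f' ⋅ f) = (g' ⋅ g) ⋅ a.
Proof.
intros E E'; rewrite comp_assoc, E', <- comp_assoc, E; apply comp_assoc.
Qed.

Definition split_ext_comp (C : SymMonCategory) (E E' E'' : SplitExtension C)
  (h : SplitExtHom E' E'') (f : SplitExtHom E E') : SplitExtHom E E''.
Proof.
refine {| sh_g := hopf_comp (sh_g h) (sh_g f);
          sh_v := hopf_comp (sh_v h) (sh_v f);
          sh_p := hopf_comp (sh_p h) (sh_p f) |}.
- abstract (symmetry; eapply square_paste; symmetry; apply sh_kappa).
- abstract (symmetry; eapply square_paste; symmetry; apply sh_e).
- abstract (eapply square_paste; apply sh_alpha).
- abstract (eapply square_paste; apply sh_lambda).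
Defined.

Definition SplitExt (C : SymMonCategory) : Category.
Proof.
refine {| Ob := SplitExtension C; Hom := @SplitExtHom C;
          idm := @split_ext_id C; comp := @split_ext_comp C |}.
- abstract (intros; apply split_ext_hom_eq; apply comp_assoc).
- abstract (intros; apply split_ext_hom_eq; apply comp_idl).
- abstract (intros; apply split_ext_hom_eq; apply comp_idr).
Defined.

(* Main.v *)
(** An action yields the smash product: on [X ⊗ B] put
      (x ⊗ b)(y ⊗ c) = x (b1 ▷ y) ⊗ b2 c,  S(x ⊗ b) = (S(b)1 ▷ S x) ⊗ S(b)2,
    with the tensor product coalgebra.  A split extension yields the action
      b ▷ x = λ(e(b) κ(x)),
    and [x ⊗ b ↦ κ(x) e(b)] identifies [A] with the smash product, with inverse
    [(λ ⊗ α) ⋅ Δ], because (3') gives the exchange rule e(b) κ(x) = κ(b1 ▷ x) e(b2).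
    Neither [X] nor [B] is associative, but [b ↦ b ▷ -] is multiplicative into an
    associative algebra of endomorphisms, so [S_L(b) ▷ -] and [S_R(b) ▷ -], being a
    left and a right convolution inverse of it, coincide; they inherit the symmetry
    b1 ⊗ (b2 ▷ x) = b2 ⊗ (b1 ▷ x), which is what the antipode axioms of the smash
    product require.

    The Sweedler calculations are done by reflection.  A wire of a string diagram is
    named by the Sweedler term it carries; coherence for permutations shows that the
    composite is determined by the output names and the multiset of boxes, and an
    equation between morphisms becomes a certified rewriting step on this data. *)

From Stdlib Require Import List PeanoNat Permutation Bool Lia Program.Equality.
Require Import Defs.
Import ListNotations.

Set Implicit Arguments.
Unset Strict Implicit.
Unset Printing Implicit Defensive.

(** Without associativity a convolution inverse need not be unique, so the antipodes of the smash
    product are not antihomomorphisms for free: their compatibility with product and coproduct has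
    to be calculated, and there the symmetries of the action are spent. The formula for S is
    nevertheless forced: κ(x) e(b) must go to e(S b) κ(S x), and the exchange rule returns this to
    the shape κ(-) e(-). In the other direction the mixed associativity laws of a split extension
    and the exchange rule bring the products that occur into this shape, on which λ can be
    evaluated.

    Naming wires by terms is faithful because diagrams are linear: each wire is consumed at most
    once, so live wires have distinct names and a box with inputs cannot occur twice on the same
    arguments. Only boxes without inputs need a tag. Equality of diagrams becomes equality of finite
    data up to the order of execution, which computation decides. Rewriting then acts on a list of
    boxes instead of a nested composite, and associators, unitors and symmetries disappear from the
    calculations. *)

Lemma comp_pre (C : Category) (W X Y Z : C) (g : Hom Y Z) (f : Hom X Y)
  (h : Hom X Z) (E : g ⋅ f = h) (k : Hom W X) : g ⋅ (f ⋅ k) = h ⋅ k.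
Proof. rewrite comp_assoc, E; reflexivity. Qed.

(** * Coherence in symmetric monoidal categories *)

Section Coherence.
Context (C : SymMonCategory).
Implicit Types W X Y Z : C.

Lemma tens_compl X Y Z W (g : Hom Y Z) (f : Hom X Y) :
  (g ⋅ f) ⊗ idm W = (g ⊗ idm W) ⋅ (f ⊗ idm W).
Proof. rewrite <- tensm_comp, comp_idl; reflexivity. Qed.

Lemma tens_compr X Y Z W (g : Hom Y Z) (f : Hom X Y) :
  idm W ⊗ (g ⋅ f) = (idm W ⊗ g) ⋅ (idm W ⊗ f).
Proof. rewrite <- tensm_comp, comp_idl; reflexivity. Qed.

Lemma tens_lr X X' Y Y' (f : Hom X X') (g : Hom Y Y') :
  (f ⊗ idm Y') ⋅ (idm X ⊗ g) = f ⊗ g.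
Proof. rewrite <- tensm_comp, comp_idl, comp_idr; reflexivity. Qed.

Lemma tens_rl X X' Y Y' (f : Hom X X') (g : Hom Y Y') :
  (idm X' ⊗ g) ⋅ (f ⊗ idm Y) = f ⊗ g.
Proof. rewrite <- tensm_comp, comp_idl, comp_idr; reflexivity. Qed.

Lemma tens_swap X X' Y Y' (f : Hom X X') (g : Hom Y Y') :
  (f ⊗ idm Y') ⋅ (idm X ⊗ g) = (idm X' ⊗ g) ⋅ (f ⊗ idm Y).
Proof. rewrite tens_lr, tens_rl; reflexivity. Qed.

Lemma epi_iso X Y Z (f g : Hom Y Z) (h : Hom X Y) (h' : Hom Y X) :
  h ⋅ h' = idm Y -> f ⋅ h = g ⋅ h -> f = g.
Proof.
intros E H; rewrite <- (comp_idr f), <- (comp_idr g), <- E, !comp_assoc, H.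
reflexivity.
Qed.

Lemma mono_iso X Y Z (f g : Hom X Y) (h : Hom Y Z) (h' : Hom Z Y) :
  h' ⋅ h = idm Y -> h ⋅ f = h ⋅ g -> f = g.
Proof.
intros E H; rewrite <- (comp_idl f), <- (comp_idl g), <- E, <- !comp_assoc, H.
reflexivity.
Qed.

Lemma lfaithful X Y (f g : Hom X Y) :
  idm (munit C) ⊗ f = idm (munit C) ⊗ g -> f = g.
Proof.
intros H; apply (epi_iso (lunit_invK X)).
rewrite <- !lunit_natural, H; reflexivity.
Qed.

Lemma rfaithful X Y (f g : Hom X Y) :
  f ⊗ idm (munit C) = g ⊗ idm (munit C) -> f = g.
Proof.
intros H; apply (epi_iso (runit_invK X)).
rewrite <- !runit_natural, H; reflexivity.
Qed.

Lemma tens_isol X Y W (f : Hom X Y) (g : Hom Y X) :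
  f ⋅ g = idm Y -> (f ⊗ idm W) ⋅ (g ⊗ idm W) = idm (Y ⊗ W).
Proof. intros E; rewrite <- tens_compl, E; apply tensm_id. Qed.

Lemma tens_isor X Y W (f : Hom X Y) (g : Hom Y X) :
  f ⋅ g = idm Y -> (idm W ⊗ f) ⋅ (idm W ⊗ g) = idm (W ⊗ Y).
Proof. intros E; rewrite <- tens_compr, E; apply tensm_id. Qed.

(** Kelly: the triangle and the pentagon suffice. *)
Lemma lunit_assoc X Y : lunit (X ⊗ Y) ⋅ assoc (munit C) X Y = lunit X ⊗ idm Y.
Proof.
apply lfaithful.
apply (epi_iso (assoc_invK (munit C) (munit C ⊗ X) Y)).
apply (epi_iso (tens_isol Y (assoc_invK (munit C) (munit C) X))).
rewrite tens_compr, <- !comp_assoc, (comp_assoc (idm _ ⊗ assoc _ _ _)), pentagon.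
rewrite !comp_assoc, triangle, <- (tensm_id X Y), <- assoc_natural.
rewrite <- !assoc_natural, <- !comp_assoc, <- !tens_compl, triangle.
reflexivity.
Qed.

(** The hexagon with two unit objects, followed by a left unitor, has [sym X (munit C)] as last
    factor on both sides; cancelling it leaves the claim tensored with the unit object. *)
Lemma lunit_sym X : lunit X ⋅ sym X (munit C) = runit X.
Proof.
apply rfaithful.
apply (mono_iso (symK X (munit C))).
pose proof (hexagon X (munit C) (munit C)) as H.
apply (f_equal (fun h => lunit _ ⋅ h)) in H.
rewrite !comp_assoc, lunit_assoc, lunit_natural in H.
rewrite <- !comp_assoc, (comp_pre (lunit_assoc _ _)) in H.
rewrite <- tens_compl, comp_assoc, <- sym_natural, <- comp_assoc, triangle in H.
symmetry; exact H.
Qed.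

Lemma runit_sym X : runit X ⋅ sym (munit C) X = lunit X.
Proof. rewrite <- lunit_sym, <- comp_assoc, symK, comp_idr; reflexivity. Qed.

(** The spectator [W] keeps the exchange inside a right-nested tensor product, so that permutations
    of a list of wires are built from [swap] and tensoring with identities on the left. *)
Definition swap X Y W : Hom (X ⊗ (Y ⊗ W)) (Y ⊗ (X ⊗ W)) :=
  assoc Y X W ⋅ (sym X Y ⊗ idm W) ⋅ assoc_inv X Y W.

Lemma assoc_inv_natural X X' Y Y' Z Z'
  (f : Hom X X') (g : Hom Y Y') (h : Hom Z Z') :
  assoc_inv X' Y' Z' ⋅ (f ⊗ (g ⊗ h)) = ((f ⊗ g) ⊗ h) ⋅ assoc_inv X Y Z.
Proof.
apply (mono_iso (assocK X' Y' Z')).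
rewrite !comp_assoc, assoc_invK, comp_idl, assoc_natural, <- comp_assoc.
rewrite assoc_invK, comp_idr; reflexivity.
Qed.

Lemma swap_natural X X' Y Y' W W'
  (f : Hom X X') (g : Hom Y Y') (h : Hom W W') :
  swap X' Y' W' ⋅ (f ⊗ (g ⊗ h)) = (g ⊗ (f ⊗ h)) ⋅ swap X Y W.
Proof.
unfold swap; rewrite <- !comp_assoc, assoc_inv_natural.
rewrite (comp_assoc (sym _ _ ⊗ _)), <- tensm_comp, sym_natural, comp_idl.
rewrite <- (comp_idr h) at 1; rewrite tensm_comp, <- !comp_assoc.
rewrite (comp_pre (assoc_natural _ _ _)), <- comp_assoc; reflexivity.
Qed.

Lemma swapK X Y W : swap Y X W ⋅ swap X Y W = idm _.
Proof.
unfold swap; rewrite <- !comp_assoc, (comp_pre (assocK _ _ _)), comp_idl.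
rewrite (comp_pre (tens_isol W (symK X Y))), comp_idl; apply assoc_invK.
Qed.

(** This is the hexagon in terms of [swap]; the pentagon moves [W] out of the way. *)
Lemma swap_tensr X Y Z W :
  (idm Y ⊗ swap X Z W) ⋅ swap X Y (Z ⊗ W)
  = assoc Y Z (X ⊗ W) ⋅ swap X (Y ⊗ Z) W ⋅ (idm X ⊗ assoc_inv Y Z W).
Proof.
apply (epi_iso (tens_isor X (assoc_invK Y Z W))).
apply (epi_iso (assoc_invK X (Y ⊗ Z) W)).
apply (epi_iso (tens_isol W (assoc_invK X Y Z))).
rewrite <- !comp_assoc.
rewrite (comp_pre (tens_isor X (assocK Y Z W))), comp_idl.
rewrite (comp_assoc (idm X ⊗ _)), pentagon.
unfold swap; rewrite <- !comp_assoc.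
rewrite (comp_pre (assocK _ _ _)), comp_idl.
rewrite (comp_pre (assocK _ _ _)), comp_idl.
rewrite <- tens_compl.
rewrite (comp_assoc (assoc Y Z (X ⊗ W))), <- pentagon.
rewrite <- !comp_assoc, <- tens_compl.
rewrite (comp_assoc (assoc Y Z X)), hexagon.
rewrite <- (tensm_id Z W), <- assoc_natural.
rewrite (comp_pre (eq_sym (pentagon _ _ _ _))).
rewrite !tens_compr, <- !comp_assoc, (comp_pre (tens_isor Y (assocK X Z W))).
rewrite comp_idl, (comp_pre (eq_sym (assoc_natural _ _ _))).
rewrite <- !comp_assoc, <- !tens_compl, !comp_assoc; reflexivity.
Qed.

Lemma swap_unitl Y W :
  (idm Y ⊗ lunit W) ⋅ swap (munit C) Y W = lunit (Y ⊗ W).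
Proof.
unfold swap; rewrite !comp_assoc, triangle, <- tens_compl, runit_sym.
rewrite <- lunit_assoc, <- comp_assoc, assoc_invK; apply comp_idr.
Qed.

(** By [swap_tensr] both sides move [X] past a tensor product of [Y] and [Z] in one go; what remains
    is naturality of that move in [sym Y Z]. *)
Lemma yang_baxter X Y Z W :
  swap Y Z (X ⊗ W) ⋅ (idm Y ⊗ swap X Z W) ⋅ swap X Y (Z ⊗ W)
  = (idm Z ⊗ swap X Y W) ⋅ swap X Z (Y ⊗ W) ⋅ (idm X ⊗ swap Y Z W).
Proof.
rewrite <- comp_assoc, !swap_tensr.
unfold swap at 1; rewrite <- !comp_assoc.
rewrite (comp_pre (assocK _ _ _)), comp_idl.
rewrite <- (tensm_id X W) at 1.
rewrite (comp_pre (eq_sym (swap_natural _ _ _))).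
unfold swap at 3; rewrite <- !comp_assoc, <- !tens_compr, !comp_assoc.
rewrite assocK, comp_idl.
reflexivity.
Qed.

End Coherence.

(** * Syntax of objects and named wires, and their flattening to lists *)

Inductive ob := OI | OA (n : nat) | OT (a b : ob).

(** [Out k b t args] is the [k]-th output of box [b] applied to [args].  The tag [t]
    separates the occurrences of a box without inputs; it is [0] for all others. *)
Inductive name := Var (i : nat) | Out (k b t : nat) (args : list name).

(** The accumulator makes the two bracketings of a triple tensor flatten to convertible lists, and
    likewise a tensor with the unit. Flattened associators and unitors are therefore endomorphisms
    by conversion and can be compared with an identity without any transport. *)
Fixpoint flat (o : ob) (A : list nat) : list nat :=
  match o with
  | OI => A
  | OA n => n :: A
  | OT a b => flat a (flat b A)
  end.

Fixpoint width (o : ob) : nat :=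
  match o with OI => 0 | OA _ => 1 | OT a b => width a + width b end.

Lemma flat_app o A : flat o A = flat o [] ++ A.
Proof.
revert A; induction o as [|n|a IHa b IHb]; intros A; simpl; try reflexivity.
rewrite (IHa (flat b [])), <- app_assoc, <- IHb; apply IHa.
Qed.

Lemma flat_length o : length (flat o []) = width o.
Proof.
induction o as [|n|a IHa b IHb]; simpl; try reflexivity.
rewrite flat_app, length_app, IHa, IHb; reflexivity.
Qed.

Lemma split_width (T : Type) (n m : nat) (l : list T) :
  length l = n + m ->
  exists l1 l2, l = l1 ++ l2 /\ length l1 = n /\ length l2 = m.
Proof.
intros H; exists (firstn n l), (skipn n l).
rewrite firstn_skipn, length_firstn, length_skipn; repeat split; lia.
Qed.

Section Wires.
Context (C : SymMonCategory) (atom : nat -> C).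

Fixpoint dob (o : ob) : C :=
  match o with
  | OI => munit C
  | OA n => atom n
  | OT a b => tens (dob a) (dob b)
  end.

Fixpoint dl (A : list nat) : C :=
  match A with
  | [] => munit C
  | n :: A => tens (atom n) (dl A)
  end.

Fixpoint fwd (o : ob) (A : list nat) : Hom (dob o ⊗ dl A) (dl (flat o A)) :=
  match o with
  | OI => lunit (dl A)
  | OA n => idm _
  | OT a b => fwd a (flat b A) ⋅ (idm (dob a) ⊗ fwd b A) ⋅ assoc _ _ _
  end.

Fixpoint bwd (o : ob) (A : list nat) : Hom (dl (flat o A)) (dob o ⊗ dl A) :=
  match o with
  | OI => lunit_inv (dl A)
  | OA n => idm _
  | OT a b => assoc_inv _ _ _ ⋅ (idm (dob a) ⊗ bwd b A) ⋅ bwd a (flat b A)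
  end.

Lemma fwdK o A : fwd o A ⋅ bwd o A = idm _.
Proof.
revert A; induction o as [|n|a IHa b IHb]; intros A; simpl.
- apply lunit_invK.
- apply comp_idl.
- rewrite <- !comp_assoc, (comp_pre (assoc_invK _ _ _)), comp_idl.
  rewrite (comp_pre (tens_isor _ (IHb _))), comp_idl; apply IHa.
Qed.

Lemma bwdK o A : bwd o A ⋅ fwd o A = idm _.
Proof.
revert A; induction o as [|n|a IHa b IHb]; intros A; simpl.
- apply lunitK.
- apply comp_idl.
- rewrite <- !comp_assoc, (comp_pre (IHa _)), comp_idl.
  rewrite (comp_pre (tens_isor _ (IHb _))), comp_idl; apply assocK.
Qed.

Definition onhead (a b : ob) (f : Hom (dob a) (dob b)) (A : list nat) :
  Hom (dl (flat a A)) (dl (flat b A)) :=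
  fwd b A ⋅ (f ⊗ idm (dl A)) ⋅ bwd a A.

Definition ontail (a : ob) (A A' : list nat) (p : Hom (dl A) (dl A')) :
  Hom (dl (flat a A)) (dl (flat a A')) :=
  fwd a A' ⋅ (idm (dob a) ⊗ p) ⋅ bwd a A.

Definition bswap (a b : ob) (A : list nat) :
  Hom (dl (flat a (flat b A))) (dl (flat b (flat a A))) :=
  fwd b (flat a A) ⋅ (idm (dob b) ⊗ fwd a A) ⋅ swap (dob a) (dob b) (dl A)
  ⋅ (idm (dob a) ⊗ bwd b A) ⋅ bwd a (flat b A).

Lemma onhead_id a A : onhead (idm (dob a)) A = idm _.
Proof. unfold onhead; rewrite tensm_id, comp_idr; apply fwdK. Qed.

Lemma onhead_comp a b c (g : Hom (dob b) (dob c)) (f : Hom (dob a) (dob b)) A :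
  onhead (g ⋅ f) A = onhead g A ⋅ onhead f A.
Proof.
unfold onhead; rewrite <- !comp_assoc, (comp_pre (bwdK _ _)), comp_idl.
rewrite tens_compl, <- comp_assoc; reflexivity.
Qed.

Lemma ontail_id a A : ontail a (idm (dl A)) = idm _.
Proof. unfold ontail; rewrite tensm_id, comp_idr; apply fwdK. Qed.

Lemma ontail_comp a A A' A'' (q : Hom (dl A') (dl A'')) (p : Hom (dl A) (dl A')) :
  ontail a (q ⋅ p) = ontail a q ⋅ ontail a p.
Proof.
unfold ontail; rewrite <- !comp_assoc, (comp_pre (bwdK _ _)), comp_idl.
rewrite tens_compr, <- comp_assoc; reflexivity.
Qed.

Lemma onhead_ontail a b A A' (f : Hom (dob a) (dob b)) (p : Hom (dl A) (dl A')) :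
  onhead f A' ⋅ ontail a p = ontail b p ⋅ onhead f A.
Proof.
unfold onhead, ontail; rewrite <- !comp_assoc, !(comp_pre (bwdK _ _)), !comp_idl.
rewrite (comp_assoc (f ⊗ _)), tens_swap, <- comp_assoc; reflexivity.
Qed.

Lemma bswapK a b A : bswap b a A ⋅ bswap a b A = idm _.
Proof.
unfold bswap; rewrite <- !comp_assoc, !(comp_pre (bwdK _ _)), !comp_idl.
rewrite (comp_pre (tens_isor _ (bwdK _ _))), comp_idl.
rewrite (comp_pre (swapK _ _ _)), comp_idl.
rewrite (comp_pre (tens_isor _ (fwdK _ _))), comp_idl; apply fwdK.
Qed.

Lemma bswap_natural a a' b A (f : Hom (dob a) (dob a')) :
  bswap a' b A ⋅ onhead f (flat b A) = ontail b (onhead f A) ⋅ bswap a b A.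
Proof.
unfold bswap, onhead, ontail.
rewrite <- !comp_assoc, !(comp_pre (bwdK _ _)), !comp_idl.
rewrite !tens_compr, <- !comp_assoc.
rewrite (comp_pre (tens_isor _ (bwdK _ _))), comp_idl.
rewrite (comp_pre (eq_sym (swap_natural _ _ _))), tensm_id, <- comp_assoc.
rewrite (comp_pre (eq_sym (tens_swap f (bwd b A)))), <- comp_assoc; reflexivity.
Qed.

Lemma ontail_onhead a b b' A (f : Hom (dob b) (dob b')) :
  ontail a (onhead f A) = bswap b' a A ⋅ onhead f (flat a A) ⋅ bswap a b A.
Proof.
rewrite bswap_natural, <- comp_assoc, bswapK; symmetry; apply comp_idr.
Qed.

Lemma onhead_tens a a' b b' (f : Hom (dob a) (dob a')) (g : Hom (dob b) (dob b')) A :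
  @onhead (OT a b) (OT a' b') (f ⊗ g) A
  = ontail a' (onhead g A) ⋅ onhead f (flat b A).
Proof.
unfold onhead, ontail; simpl.
rewrite <- !comp_assoc, !(comp_pre (bwdK _ _)), !comp_idl.
rewrite (comp_pre (assoc_natural _ _ _)), <- !comp_assoc.
rewrite (comp_pre (assoc_invK _ _ _)), comp_idl.
rewrite !tens_compr, <- !comp_assoc, (comp_pre (eq_sym (tens_swap f _))), <- !comp_assoc.
rewrite (comp_pre (tens_rl f _)).
reflexivity.
Qed.

Lemma ontail_tens a b A A' (p : Hom (dl A) (dl A')) :
  ontail (OT a b) p = ontail a (ontail b p).
Proof.
unfold ontail; simpl.
rewrite <- !comp_assoc, <- (tensm_id (dob a) (dob b)).
rewrite (comp_pre (assoc_natural _ _ _)), <- !comp_assoc.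
rewrite (comp_pre (assoc_invK _ _ _)), comp_idl, !tens_compr, <- !comp_assoc.
reflexivity.
Qed.

Lemma ontail_unit A A' (p : Hom (dl A) (dl A')) : ontail OI p = p.
Proof.
unfold ontail; simpl.
rewrite lunit_natural, <- comp_assoc, lunit_invK; apply comp_idr.
Qed.

Lemma ontail_atom n A A' (p : Hom (dl A) (dl A')) :
  ontail (OA n) p = idm (atom n) ⊗ p.
Proof. unfold ontail; simpl; rewrite comp_idl; apply comp_idr. Qed.

Lemma onhead_assoc a b c A :
  @onhead (OT (OT a b) c) (OT a (OT b c)) (assoc _ _ _) A = idm _.
Proof.
rewrite <- (fwdK (OT (OT a b) c)); unfold onhead; f_equal; simpl.
rewrite !tens_compr, <- !comp_assoc, (comp_assoc (idm (dob a) ⊗ _)).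
rewrite (comp_assoc (idm _ ⊗ assoc _ _ _)), pentagon.
rewrite <- (tensm_id (dob a) (dob b)).
rewrite (comp_pre (assoc_natural _ _ _)), <- !comp_assoc; reflexivity.
Qed.

Lemma onhead_inv a b (f : Hom (dob a) (dob b)) (g : Hom (dob b) (dob a)) A :
  g ⋅ f = idm _ -> forall p q, onhead f A = p -> q ⋅ p = idm _ ->
  p ⋅ q = idm _ -> onhead g A = q.
Proof.
intros E p q Ef Eqp Epq.
apply (epi_iso (h := p) (h' := q)); [exact Epq|].
rewrite Eqp, <- Ef, <- onhead_comp, E; apply onhead_id.
Qed.

Lemma onhead_assoc_inv a b c A :
  @onhead (OT a (OT b c)) (OT (OT a b) c) (assoc_inv _ _ _) A = idm _.
Proof.
refine (@onhead_inv (OT (OT a b) c) (OT a (OT b c)) _ _ _ _ (idm _) (idm _)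
  (onhead_assoc a b c A) _ _).
- apply assocK.
- apply comp_idl.
- apply comp_idl.
Qed.

Lemma onhead_lunit a A : @onhead (OT OI a) a (lunit _) A = idm _.
Proof.
rewrite <- (fwdK (OT OI a)); unfold onhead; f_equal; simpl.
rewrite lunit_natural, <- lunit_assoc, comp_assoc; reflexivity.
Qed.

Lemma onhead_lunit_inv a A : @onhead a (OT OI a) (lunit_inv _) A = idm _.
Proof.
refine (@onhead_inv (OT OI a) a _ _ _ _ (idm _) (idm _) (onhead_lunit a A) _ _).
- apply lunitK.
- apply comp_idl.
- apply comp_idl.
Qed.

Lemma onhead_runit a A : @onhead (OT a OI) a (runit _) A = idm _.
Proof.
rewrite <- (fwdK (OT a OI)); unfold onhead; f_equal; simpl.
rewrite <- comp_assoc, triangle; reflexivity.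
Qed.

Lemma onhead_runit_inv a A : @onhead a (OT a OI) (runit_inv _) A = idm _.
Proof.
refine (@onhead_inv (OT a OI) a _ _ _ _ (idm _) (idm _) (onhead_runit a A) _ _).
- apply runitK.
- apply comp_idl.
- apply comp_idl.
Qed.

Lemma onhead_sym a b A :
  @onhead (OT a b) (OT b a) (sym _ _) A = bswap a b A.
Proof.
unfold onhead, bswap, swap; simpl; rewrite !comp_assoc; reflexivity.
Qed.

(** * Coherence of permutations *)

Inductive adj_swap : forall A A', list name -> list name -> Hom (dl A) (dl A') -> Prop :=
| AdjHere i j A x y ns :
    @adj_swap (i :: j :: A) (j :: i :: A) (x :: y :: ns) (y :: x :: ns)
      (swap (atom i) (atom j) (dl A))
| AdjThere i x A A' ns ns' (s : Hom (dl A) (dl A')) :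
    adj_swap ns ns' s ->
    @adj_swap (i :: A) (i :: A') (x :: ns) (x :: ns') (idm (atom i) ⊗ s).

(** A relation, since one morphism can be such a composite in many ways; that distinct names
    determine it is [perm_unique]. *)
Inductive perm_mor A ns : forall A', list name -> Hom (dl A) (dl A') -> Prop :=
| PermId : length ns = length A -> @perm_mor A ns A ns (idm _)
| PermSwap A' A'' ns' ns'' (p : Hom (dl A) (dl A')) (s : Hom (dl A') (dl A'')) :
    perm_mor ns ns' p -> adj_swap ns' ns'' s -> perm_mor ns ns'' (s ⋅ p).

(** Moving the wire [x] rightwards to one place; [canon] is insertion sort. *)
Inductive insertion i x :
  forall A A', list name -> list name -> Hom (dl (i :: A)) (dl A') -> Prop :=
| Ins0 A ns : @insertion i x A (i :: A) ns (x :: ns) (idm _)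
| InsS j y A A' ns ns' (p : Hom (dl (i :: A)) (dl A')) :
    insertion x ns ns' p ->
    @insertion i x (j :: A) (j :: A') (y :: ns) (y :: ns')
      ((idm (atom j) ⊗ p) ⋅ swap (atom i) (atom j) (dl A)).

Inductive canon : forall A A', list name -> list name -> Hom (dl A) (dl A') -> Prop :=
| Canon0 : @canon [] [] [] [] (idm _)
| CanonS i x A A' A'' ns ns' ns'' (f : Hom (dl A) (dl A'))
    (p : Hom (dl (i :: A')) (dl A'')) :
    canon ns ns' f -> insertion x ns' ns'' p ->
    @canon (i :: A) A'' (x :: ns) ns'' (p ⋅ (idm (atom i) ⊗ f)).

(** Either the swap exchanges two wires other than [x] and can be done before the insertion, or it
    moves [x] by one place and the result is again an insertion. *)
Lemma insertion_swap i x A1 A' A'' ns1 ns' ns'' (p : Hom (dl (i :: A1)) (dl A'))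
  (s : Hom (dl A') (dl A'')) :
  insertion x ns1 ns' p -> adj_swap ns' ns'' s ->
  (exists A2 ns2 (s' : Hom (dl A1) (dl A2)) (p' : Hom (dl (i :: A2)) (dl A'')),
     adj_swap ns1 ns2 s' /\ insertion x ns2 ns'' p' /\
     s ⋅ p = p' ⋅ (idm (atom i) ⊗ s'))
  \/ insertion x ns1 ns'' (s ⋅ p).
Proof.
intros H; revert A'' ns'' s; induction H as [A ns|j y A A' ns ns' p H IH];
  intros A'' ns'' s Hs.
- dependent destruction Hs.
  + right; rewrite comp_idr, <- (comp_idl (swap _ _ _)), <- tensm_id.
    do 2 constructor.
  + left; exists A', ns', s0, (idm _); repeat split; [exact Hs | constructor |].
    rewrite comp_idl; apply comp_idr.
- dependent destruction Hs.
  + clear IH; dependent destruction H.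
    * right; simpl; rewrite tensm_id, comp_idl, swapK; constructor.
    (* Here [x] has already passed both swapped wires, and the braid relation moves the swap in
       front. *)
    * left; exists (j0 :: j :: A), (y0 :: y :: ns), (swap _ _ _),
        ((idm (atom j0) ⊗ ((idm (atom j) ⊗ p0) ⋅ swap _ _ _)) ⋅ swap _ _ _).
      repeat split; [constructor | do 2 constructor; assumption |].
      rewrite !tens_compr, <- !comp_assoc.
      pose proof (swap_natural (idm (atom j)) (idm (atom j0)) p0) as E.
      simpl in *; rewrite (comp_pre E), <- comp_assoc.
      f_equal; rewrite !comp_assoc; apply yang_baxter.
  + destruct (IH _ _ _ Hs) as [(A2 & ns2 & s' & p' & H1 & H2 & E) | H1].
    * left; exists (j :: A2), (y :: ns2), (idm _ ⊗ s'),
        ((idm (atom j) ⊗ p') ⋅ swap _ _ _).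
      repeat split; [constructor; assumption | constructor; assumption |].
      simpl in *; rewrite comp_assoc, <- tens_compr, E, tens_compr, <- !comp_assoc.
      f_equal; symmetry; apply swap_natural.
    * right; simpl in *; rewrite comp_assoc, <- tens_compr; exact (InsS _ _ H1).
Qed.

Lemma canon_swap A A' A'' ns ns' ns'' (f : Hom (dl A) (dl A'))
  (s : Hom (dl A') (dl A'')) :
  canon ns ns' f -> adj_swap ns' ns'' s -> canon ns ns'' (s ⋅ f).
Proof.
intros H; revert A'' ns'' s;
  induction H as [|i x A A' A'' ns ns' ns'' f p H IH Hp]; intros A3 ns3 s Hs.
- inversion Hs.
- destruct (insertion_swap Hp Hs) as [(A2 & ns2 & s' & p' & H1 & H2 & E) | H1].
  + simpl in *; rewrite comp_assoc, E, <- comp_assoc, <- tens_compr.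
    econstructor; [apply IH; exact H1 | exact H2].
  + rewrite comp_assoc; econstructor; eassumption.
Qed.

Lemma canon_id A ns : length ns = length A -> canon ns ns (idm (dl A)).
Proof.
revert ns; induction A as [|i A IH]; intros [|x ns] H; try discriminate H.
- constructor.
- replace (idm (dl (i :: A))) with (idm (dl (i :: A)) ⋅ (idm (atom i) ⊗ idm (dl A))).
  + econstructor; [apply IH; simpl in H; lia | constructor].
  + rewrite tensm_id; apply comp_idl.
Qed.

Lemma perm_canon A A' ns ns' (p : Hom (dl A) (dl A')) :
  perm_mor ns ns' p -> canon ns ns' p.
Proof.
induction 1 as [H|A' A'' ns' ns'' p s H IH Hs].
- apply canon_id; exact H.
- exact (canon_swap IH Hs).
Qed.

Lemma insertion_In i x A A' ns ns' (p : Hom (dl (i :: A)) (dl A')) :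
  insertion x ns ns' p -> In x ns'.
Proof. induction 1; [left | right]; auto. Qed.

Lemma insertion_perm i x A A' ns ns' (p : Hom (dl (i :: A)) (dl A')) :
  insertion x ns ns' p -> Permutation (x :: ns) ns'.
Proof.
induction 1; [reflexivity|].
eapply perm_trans; [apply perm_swap | apply perm_skip; assumption].
Qed.

(** Distinct names leave a single place for [x] in [ns'], which fixes every choice of the
    derivation. The sources [A1] and [A2] agree only a posteriori, hence [JMeq]. *)
Lemma insertion_unique i x A1 A2 A' ns1 ns2 ns' (p : Hom (dl (i :: A1)) (dl A'))
  (q : Hom (dl (i :: A2)) (dl A')) :
  insertion x ns1 ns' p -> insertion x ns2 ns' q -> NoDup ns' ->
  A1 = A2 /\ ns1 = ns2 /\ JMeq p q.
Proof.
intros H; revert A2 ns2 q; induction H as [A ns|j y A A' ns ns' p H IH];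
  intros A2 ns2 q Hq D.
- dependent destruction Hq; [repeat split; reflexivity|].
  apply insertion_In in Hq; inversion D; contradiction.
- inversion D as [|? ? D1 D2]; subst.
  dependent destruction Hq.
  + apply insertion_In in H; contradiction.
  + destruct (IH _ _ _ Hq D2) as (E1 & E2 & E3); subst; repeat split; reflexivity.
Qed.

Lemma canon_unique A A' ns ns' (p q : Hom (dl A) (dl A')) :
  canon ns ns' p -> canon ns ns' q -> NoDup ns' -> p = q.
Proof.
intros H; revert q; induction H as [|i x A A' A'' ns ns' ns'' f p H IH Hp];
  intros q Hq D.
- dependent destruction Hq; reflexivity.
- dependent destruction Hq.
  destruct (insertion_unique Hp H0 D) as (E1 & E2 & E3); subst.
  assert (D' : NoDup (x :: ns'0)).
  { apply (Permutation_NoDup (Permutation_sym (insertion_perm Hp))); exact D. }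
  inversion D'; subst; rewrite (IH _ Hq) by assumption; reflexivity.
Qed.

(** Coherence: every composite of swaps is also an insertion sort, and with distinct target names
    there is only one. *)
Theorem perm_unique A A' ns ns' (p q : Hom (dl A) (dl A')) :
  perm_mor ns ns' p -> perm_mor ns ns' q -> NoDup ns' -> p = q.
Proof. intros; eapply canon_unique; eauto using perm_canon. Qed.

End Wires.

(** * Lists, and decidable equality of names and nodes *)

Lemma combine_app (S T : Type) (l1 l2 : list S) (m1 m2 : list T) :
  length l1 = length m1 ->
  combine (l1 ++ l2) (m1 ++ m2) = combine l1 m1 ++ combine l2 m2.
Proof.
revert m1; induction l1 as [|x l1 IH]; intros [|y m1] H; try discriminate H.
- reflexivity.
- simpl; f_equal; apply IH; simpl in H; lia.
Qed.

Lemma map_fst_combine (S T : Type) (l : list S) (m : list T) :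
  length l = length m -> map fst (combine l m) = l.
Proof.
revert m; induction l as [|x l IH]; intros [|y m] H; try discriminate H.
- reflexivity.
- simpl; f_equal; apply IH; simpl in H; lia.
Qed.

Lemma map_snd_combine (S T : Type) (l : list S) (m : list T) :
  length l = length m -> map snd (combine l m) = m.
Proof.
revert m; induction l as [|x l IH]; intros [|y m] H; try discriminate H.
- reflexivity.
- simpl; f_equal; apply IH; simpl in H; lia.
Qed.

Lemma incl_Permutation (T : Type) (l m : list T) :
  NoDup l -> incl l m -> exists r, Permutation m (l ++ r).
Proof.
revert m; induction l as [|x l IH]; intros m D I.
- exists m; reflexivity.
- inversion D as [|? ? D1 D2]; subst.
  destruct (in_split x m) as (m1 & m2 & E); [apply I; left; reflexivity|]; subst.
  destruct (IH (m1 ++ m2) D2) as (r & Hr).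
  + intros y Hy; assert (Hm := I y (or_intror Hy)).
    rewrite in_app_iff in *; simpl in Hm; intuition congruence.
  + exists r; rewrite <- Permutation_middle; simpl; apply perm_skip; exact Hr.
Qed.

Fixpoint name_ind' (P : name -> Prop) (HV : forall i, P (Var i))
  (HO : forall k b t args, Forall P args -> P (Out k b t args)) (x : name) : P x :=
  match x with
  | Var i => HV i
  | Out k b t args =>
      HO k b t args
        ((fix all l : Forall P l :=
            match l with
            | [] => Forall_nil P
            | y :: l => Forall_cons y (name_ind' HV HO y) (all l)
            end) args)
  end.

Fixpoint eqb_name (x y : name) : bool :=
  match x, y with
  | Var i, Var j => i =? j
  | Out k b t l, Out k' b' t' l' =>
      (b =? b') && ((k =? k') && ((t =? t') &&
      (fix eqs l l' :=
         match l, l' with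
         | [], [] => true
         | a :: l, a' :: l' => eqb_name a a' && eqs l l'
         | _, _ => false
         end) l l'))
  | _, _ => false
  end.

Lemma eqb_nameP x y : eqb_name x y = true <-> x = y.
Proof.
revert y; induction x as [i | k b t l IH] using name_ind'; intros [j | k' b' t' l'];
  simpl; try (split; discriminate).
- rewrite Nat.eqb_eq; split; congruence.
- rewrite !andb_true_iff, !Nat.eqb_eq.
  match goal with |- _ /\ _ /\ _ /\ ?e = true <-> _ =>
    assert (E : e = true <-> l = l') end.
  { revert l'; induction IH as [|x l Hx Hl IHl]; intros [|y l'];
      try (split; congruence).
    rewrite andb_true_iff, Hx, IHl; split; [intros [-> ->] | intros [=]]; auto. }
  rewrite E; split; [intros (-> & -> & -> & ->) | intros [=]]; auto.
Qed.

Definition eqb_list (T : Type) (eqb : T -> T -> bool) :=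
  fix eqs (l l' : list T) : bool :=
    match l, l' with
    | [], [] => true
    | x :: l, x' :: l' => eqb x x' && eqs l l'
    | _, _ => false
    end.

Lemma eqb_listP (T : Type) (eqb : T -> T -> bool) :
  (forall x y, eqb x y = true -> x = y) ->
  forall l l', eqb_list eqb l l' = true -> l = l'.
Proof.
intros H; induction l as [|x l IH]; intros [|y l']; simpl; try discriminate; auto.
rewrite andb_true_iff; intros [E1 E2]; f_equal; auto.
Qed.

Definition node : Type := nat * nat * list name.

Definition eqb_node (n m : node) : bool :=
  let '(b, t, l) := n in
  let '(b', t', l') := m in
  (b =? b') && ((t =? t') && eqb_list eqb_name l l').

Lemma eqb_nodeP n m : eqb_node n m = true <-> n = m.
Proof.
destruct n as [[b t] l], m as [[b' t'] l']; simpl.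
rewrite !andb_true_iff, !Nat.eqb_eq; split.
- intros (-> & -> & E); f_equal; revert E; apply eqb_listP.
  intros x y; apply eqb_nameP.
- intros [= -> -> ->]; repeat split; induction l' as [|x l' IH]; simpl; auto.
  rewrite IH, (proj2 (eqb_nameP x x)); auto.
Qed.

Lemma node_dec (n m : node) : n = m \/ n <> m.
Proof.
destruct (eqb_node n m) eqn:E; [left; apply eqb_nodeP; exact E | right].
rewrite <- eqb_nodeP, E; discriminate.
Qed.

(** * Permutations of named wires as morphisms *)

Section Wires.
Context (C : SymMonCategory) (atom : nat -> C).
Notation dob := (dob atom).
Notation dl := (dl atom).
Notation bswap := (bswap atom).

Lemma adj_swap_perm A A' ns ns' (s : Hom (dl A) (dl A')) :
  adj_swap ns ns' s ->
  Permutation (combine A ns) (combine A' ns') /\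
  (length ns = length A -> length ns' = length A').
Proof.
induction 1 as [|i x A A' ns ns' s H [IH1 IH2]]; simpl; split.
- apply perm_swap.
- auto.
- apply perm_skip; exact IH1.
- intros E; f_equal; apply IH2; lia.
Qed.

Lemma perm_mor_perm A A' ns ns' (p : Hom (dl A) (dl A')) :
  perm_mor ns ns' p ->
  Permutation (combine A ns) (combine A' ns') /\
  length ns = length A /\ length ns' = length A'.
Proof.
induction 1 as [|A' A'' ns' ns'' p s H [IH1 [IH2 IH3]] Hs]; [auto|].
destruct (adj_swap_perm Hs) as [H1 H2]; repeat split; auto.
eapply perm_trans; eassumption.
Qed.

Lemma perm_mor_names A A' ns ns' (p : Hom (dl A) (dl A')) :
  perm_mor ns ns' p -> Permutation ns ns'.
Proof.
intros H; destruct (perm_mor_perm H) as (H1 & H2 & H3).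
apply (Permutation_map snd) in H1.
rewrite !map_snd_combine in H1 by auto; exact H1.
Qed.

Lemma perm_mor_trans A A' A'' ns ns' ns'' (p : Hom (dl A) (dl A'))
  (q : Hom (dl A') (dl A'')) :
  perm_mor ns ns' p -> perm_mor ns' ns'' q -> perm_mor ns ns'' (q ⋅ p).
Proof.
intros H1 H2; induction H2 as [E|A2 A3 ns2 ns3 q s H2 IH Hs].
- rewrite comp_idl; exact H1.
- rewrite <- comp_assoc; econstructor; eassumption.
Qed.

Lemma perm_mor_cons i x A A' ns ns' (p : Hom (dl A) (dl A')) :
  perm_mor ns ns' p ->
  perm_mor (A := i :: A) (A' := i :: A') (x :: ns) (x :: ns') (idm (atom i) ⊗ p).
Proof.
induction 1 as [E|A2 A3 ns2 ns3 q s H IH Hs].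
- rewrite tensm_id; exact (PermId atom (A := i :: A) (ns := x :: ns) (f_equal S E)).
- rewrite tens_compr; exact (PermSwap IH (AdjThere i x Hs)).
Qed.

Lemma perm_mor_swap i j A x y ns :
  length ns = length A ->
  perm_mor (A := i :: j :: A) (A' := j :: i :: A) (x :: y :: ns) (y :: x :: ns)
    (swap (atom i) (atom j) (dl A)).
Proof.
intros E; rewrite <- (comp_idr (swap _ _ _)).
refine (PermSwap (A := i :: j :: A) (A' := i :: j :: A) _ (AdjHere atom i j A x y ns)).
apply PermId; simpl; congruence.
Qed.

Lemma perm_mor_exists G G' :
  Permutation G G' ->
  exists p : Hom (dl (map fst G)) (dl (map fst G')),
    perm_mor (map snd G) (map snd G') p.
Proof.
induction 1 as [|[i x] G G' H [p IH]|[i x] [j y] G|G1 G2 G3 H1 [p IH1] H2 [q IH2]].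
- exists (idm _); constructor; reflexivity.
- exists (idm (atom i) ⊗ p); apply perm_mor_cons; exact IH.
- exists (swap (atom j) (atom i) (dl (map fst G))); apply perm_mor_swap.
  exact (eq_trans (length_map snd G) (eq_sym (length_map fst G))).
- exists (q ⋅ p); eapply perm_mor_trans; eassumption.
Qed.

Lemma perm_mor_combine A A' ns ns' :
  length ns = length A -> length ns' = length A' ->
  Permutation (combine A ns) (combine A' ns') ->
  exists p : Hom (dl A) (dl A'), perm_mor ns ns' p.
Proof.
intros E E' H; apply perm_mor_exists in H.
rewrite !map_fst_combine, !map_snd_combine in H by auto; exact H.
Qed.

Lemma perm_mor_ontail a xs A A' ns ns' (p : Hom (dl A) (dl A')) :
  length xs = width a -> perm_mor ns ns' p ->
  perm_mor (xs ++ ns) (xs ++ ns') (ontail a p).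
Proof.
revert xs A A' ns ns' p; induction a as [|n|a IHa b IHb]; simpl;
  intros xs A A' ns ns' p E H.
- destruct xs; [|discriminate]; rewrite ontail_unit; exact H.
- destruct xs as [|x [|]]; try discriminate; rewrite ontail_atom.
  apply perm_mor_cons; exact H.
- destruct (split_width E) as (l1 & l2 & -> & E1 & E2).
  rewrite ontail_tens, <- !app_assoc; auto.
Qed.

Lemma bswap_unitl b A : bswap OI b A = idm (dl (flat b A)).
Proof.
unfold bswap; simpl.
rewrite <- (comp_assoc (fwd _ _ _)), swap_unitl, <- !comp_assoc.
rewrite (comp_pre (lunit_natural _)), <- comp_assoc, lunit_invK, comp_idr.
apply fwdK.
Qed.

Lemma bswap_tensr a b c A :
  bswap a (OT b c) A
  = ontail b (bswap a c A) ⋅ bswap a b (flat c A) :> Hom (dl _) (dl _).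
Proof.
unfold bswap, ontail; simpl.
rewrite <- !comp_assoc, !(comp_pre (bwdK _ _ _)), !comp_idl.
rewrite <- (tensm_id (dob b) (dob c)), (comp_pre (assoc_natural _ _ _)).
rewrite !tens_compr, <- !comp_assoc.
rewrite (comp_pre (tens_isor _ (bwdK _ _ _))), comp_idl.
rewrite (comp_pre (eq_sym (swap_natural _ _ _))), <- !comp_assoc.
rewrite (comp_assoc _ (swap (dob a) (dob b) _)), swap_tensr, <- !comp_assoc.
reflexivity.
Qed.

Lemma bswap_tensl a b c A :
  bswap (OT a b) c A
  = bswap a c (flat b A) ⋅ ontail a (bswap b c A) :> Hom (dl _) (dl _).
Proof.
apply (mono_iso (bswapK atom c (OT a b) A)); rewrite bswapK, bswap_tensr.
rewrite <- comp_assoc, (comp_pre (bswapK _ _ _ _)), comp_idl.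
simpl; rewrite <- ontail_comp, bswapK, ontail_id; reflexivity.
Qed.

(** The hexagons [bswap_tensl] and [bswap_tensr] split both blocks until single wires remain. *)
Lemma perm_mor_bswap a b A xs ys ns :
  length xs = width a -> length ys = width b -> length ns = length A ->
  perm_mor (xs ++ ys ++ ns) (ys ++ xs ++ ns) (bswap a b A : Hom (dl _) (dl _)).
Proof.
assert (L : forall o A (xs ns : list name), length xs = width o -> length ns = length A ->
  length (xs ++ ns) = length (flat o A)).
{ intros o B us ms H1 H2; rewrite flat_app, !length_app, flat_length; lia. }
revert A xs ys ns; induction a as [|i|a IHa a' IHa']; simpl;
  intros A xs ys ns E1 E2 E3.
- destruct xs; [|discriminate]; rewrite bswap_unitl; constructor; auto.
- destruct xs as [|x [|]]; try discriminate; clear E1.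
  revert A ys ns E2 E3; induction b as [|j|b IHb b' IHb']; simpl;
    intros A ys ns E2 E3.
  + destruct ys; [|discriminate].
    pose proof (bswapK atom OI (OA i) A) as K.
    rewrite bswap_unitl, comp_idr in K; simpl in *; rewrite K.
    apply (PermId atom (A := i :: A)); simpl; lia.
  + destruct ys as [|y [|]]; try discriminate.
    replace (bswap (OA i) (OA j) A : Hom (dl _) (dl _))
      with (swap (atom i) (atom j) (dl A)).
    * apply perm_mor_swap; exact E3.
    * unfold bswap; simpl; rewrite !tensm_id, !comp_idl, !comp_idr; reflexivity.
  + destruct (split_width E2) as (l1 & l2 & -> & F1 & F2).
    rewrite bswap_tensr, <- !app_assoc.
    eapply perm_mor_trans; [apply IHb; auto | apply perm_mor_ontail; auto].
    apply IHb'; auto.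
- destruct (split_width E1) as (l1 & l2 & -> & F1 & F2).
  rewrite bswap_tensl, <- !app_assoc.
  eapply perm_mor_trans; [apply perm_mor_ontail; auto | apply IHa; auto].
Qed.

Lemma perm_mor_map (h : name -> name) A A' ns ns' (p : Hom (dl A) (dl A')) :
  perm_mor ns ns' p -> perm_mor (map h ns) (map h ns') p.
Proof.
induction 1 as [E|A2 A3 ns2 ns3 q s H IH Hs].
- constructor; rewrite length_map; exact E.
- econstructor; [exact IH|].
  clear - Hs; induction Hs; simpl; constructor; assumption.
Qed.

(** * Programs *)

Record box := Box {
  bdom : ob;
  bcod : ob;
  bmor : Hom (dob bdom) (dob bcod)
}.

Context (env : nat -> box).

Definition outs (n : node) : list name :=
  let '(b, t, args) := n in
  map (fun k => Out k b t args) (seq 0 (width (bcod (env b)))).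

(** [runs ns0 ns N f]: executing the nodes [N], most recent first, leads from the
    wires [ns0] to the wires [ns] and composes to [f]. *)
Inductive runs A0 ns0 : forall A, list name -> list node -> Hom (dl A0) (dl A) -> Prop :=
| RunsId : length ns0 = length A0 -> @runs A0 ns0 A0 ns0 [] (idm _)
| RunsPerm A A' ns ns' N (f : Hom (dl A0) (dl A)) (p : Hom (dl A) (dl A')) :
    runs ns0 ns N f -> perm_mor ns ns' p -> runs ns0 ns' N (p ⋅ f)
| RunsBox b t args A ns N (f : Hom (dl A0) (dl (flat (bdom (env b)) A))) :
    length args = width (bdom (env b)) ->
    runs ns0 (args ++ ns) N f ->
    @runs A0 ns0 (flat (bcod (env b)) A) (outs (b, t, args) ++ ns)
      ((b, t, args) :: N) (onhead (bmor (env b)) A ⋅ f).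

Lemma outs_length b t args :
  length (outs (b, t, args)) = width (bcod (env b)).
Proof. simpl; rewrite length_map, length_seq; reflexivity. Qed.

Lemma runs_length A0 ns0 A ns N (f : Hom (dl A0) (dl A)) :
  runs ns0 ns N f -> length ns = length A.
Proof.
induction 1 as [E|A A' ns ns' N f p H IH Hp|b t args A ns N f E H IH]; auto.
- apply perm_mor_perm in Hp; intuition.
- rewrite flat_app, !length_app, flat_length, outs_length in *; lia.
Qed.

Lemma runs_comp A0 ns0 A1 ns1 A ns M N (f : Hom (dl A0) (dl A1))
  (g : Hom (dl A1) (dl A)) :
  runs ns0 ns1 N f -> runs ns1 ns M g -> runs ns0 ns (M ++ N) (g ⋅ f).
Proof.
intros Hf; induction 1 as [E|A A' ns ns' M g p H IH Hp|b t args A ns M g E H IH].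
- rewrite comp_idl; exact Hf.
- rewrite <- comp_assoc; eapply RunsPerm; eassumption.
- rewrite <- comp_assoc; exact (RunsBox t E IH).
Qed.

Section Map.
Context (h : name -> name) (ht : nat -> nat).
Hypothesis hO : forall k b t args, h (Out k b t args) = Out k b (ht t) (map h args).

Definition map_node (n : node) : node :=
  let '(b, t, args) := n in (b, ht t, map h args).

(** Renaming does not touch the morphism as long as the outputs of a box are renamed along with its
    arguments, which is [hO]. On variables [h] is free, so a variable may be replaced by the output
    of a box. *)
Lemma runs_map A0 ns0 A ns N (f : Hom (dl A0) (dl A)) :
  runs ns0 ns N f -> runs (map h ns0) (map h ns) (map map_node N) f.
Proof.
induction 1 as [E|A A' ns ns' M f p H IH Hp|b t args A ns M f E H IH].
- constructor; rewrite length_map; exact E.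
- eapply RunsPerm; [exact IH | apply perm_mor_map; exact Hp].
- rewrite map_app in *.
  replace (map h (outs (b, t, args))) with (outs (b, ht t, map h args)).
  + apply RunsBox; [rewrite length_map|]; assumption.
  + simpl; rewrite map_map; apply map_ext; intros k; symmetry; apply hO.
Qed.

End Map.

(** An output name contains the node that produced it. A node that has not been run before therefore
    creates only new names. *)
Lemma runs_names A0 ns0 A ns N (f : Hom (dl A0) (dl A)) :
  runs ns0 ns N f -> NoDup ns0 -> (forall x, In x ns0 -> exists i, x = Var i) ->
  NoDup N ->
  NoDup ns /\ forall k b t args, In (Out k b t args) ns -> In (b, t, args) N.
Proof.
intros H D0 V0; induction H as [E|A A' ns ns' M f p H IH Hp|b t args A ns M f E H IH];
  intros DN.
- split; [exact D0|]; intros k b t args HI; destruct (V0 _ HI); discriminate.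
- destruct (IH DN) as [IH1 IH2]; apply perm_mor_names in Hp; split.
  + eapply Permutation_NoDup; eassumption.
  + intros k b t args HI; apply IH2 with k.
    eapply Permutation_in; [apply Permutation_sym|]; eassumption.
- inversion DN as [|? ? D1 D2]; subst; destruct (IH D2) as [IH1 IH2].
  apply NoDup_app_remove_l in IH1 as IH3; split.
  + apply NoDup_app; [|exact IH3|].
    * apply FinFun.Injective_map_NoDup; [intros k k' [=]; assumption | apply seq_NoDup].
    * intros x HI HI'; apply in_map_iff in HI; destruct HI as (k & <- & _).
      apply D1, IH2 with k; apply in_or_app; right; exact HI'.
  + intros k b' t' args' HI; apply in_app_or in HI; destruct HI as [HI | HI].
    * apply in_map_iff in HI; destruct HI as (k' & [=] & _); subst; left; auto.
    * right; apply IH2 with k; apply in_or_app; right; exact HI.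
Qed.

Lemma box_interchange a a' b b' (f : Hom (dob a) (dob a')) (g : Hom (dob b) (dob b')) A :
  bswap b' a' A ⋅ onhead g (flat a' A) ⋅ bswap a' b A ⋅ onhead f (flat b A)
    ⋅ bswap b a A
  = onhead f (flat b' A) ⋅ bswap b' a A ⋅ onhead g (flat a A)
    :> Hom (dl _) (dl _).
Proof.
rewrite <- ontail_onhead, <- onhead_ontail, <- !comp_assoc; f_equal.
rewrite ontail_onhead, <- !comp_assoc, bswapK, comp_idr; reflexivity.
Qed.

Section Unique.
Context (A0 : list nat) (ns0 : list name).
Hypothesis D0 : NoDup ns0.
Hypothesis V0 : forall x, In x ns0 -> exists i, x = Var i.

(** A box whose outputs have not been consumed can be taken to be the last one. *)
Lemma runs_peel A ns N (g : Hom (dl A0) (dl A)) b t args :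
  runs ns0 ns N g -> NoDup N -> In (b, t, args) N ->
  incl (outs (b, t, args)) ns ->
  exists A1 ns1 N1 (g1 : Hom (dl A0) (dl (flat (bdom (env b)) A1)))
    (q : Hom (dl (flat (bcod (env b)) A1)) (dl A)),
    runs ns0 (args ++ ns1) N1 g1 /\ length args = width (bdom (env b)) /\
    Permutation N ((b, t, args) :: N1) /\
    perm_mor (outs (b, t, args) ++ ns1) ns q /\
    g = q ⋅ onhead (bmor (env b)) A1 ⋅ g1.
Proof.
intros H; induction H as [E|A A' ns ns' N f p H IH Hp|b' t' args' A ns N f E H IH];
  intros DN HN HI.
- destruct HN.
- destruct IH as (A1 & ns1 & N1 & g1 & q & H1 & H2 & H3 & H4 & ->); auto.
  { intros x Hx; apply perm_mor_names in Hp.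
    eapply Permutation_in; [apply Permutation_sym; exact Hp | apply HI; exact Hx]. }
  exists A1, ns1, N1, g1, (p ⋅ q); repeat split; auto.
  + eapply perm_mor_trans; eassumption.
  + rewrite !comp_assoc; reflexivity.
- assert (RL : length ns = length A).
  { apply runs_length in H; rewrite flat_app, !length_app, flat_length in H; lia. }
  destruct (node_dec (b', t', args') (b, t, args)) as [EQ | NE].
  { injection EQ; intros -> -> ->; clear EQ HI.
    exists A, ns, N, f, (idm _); repeat split; auto.
    - constructor; rewrite flat_app, !length_app, flat_length, outs_length; lia.
    - rewrite comp_idl; reflexivity. }
  destruct HN as [HN | HN]; [contradiction|].
  inversion DN as [|? ? DN1 DN2]; subst.
  destruct (runs_names H D0 V0 DN2) as [D1 N1].
  assert (I1 : incl (outs (b, t, args)) ns).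
  { intros x Hx; destruct (in_app_or _ _ _ (HI x Hx)) as [Hx' | Hx']; auto.
    apply in_map_iff in Hx, Hx'; destruct Hx as (k & <- & _), Hx' as (k' & E' & _).
    injection E'; intros; subst; contradiction. }
  destruct IH as (A1 & ns1 & M & g1 & q & H1 & H2 & H3 & H4 & ->); auto.
  { apply incl_appr; exact I1. }
  destruct (perm_mor_perm H4) as (P1 & L1 & L2).
  rewrite flat_app, length_app, outs_length, length_app, flat_length in L1.
  rewrite (flat_app (bcod (env b))), (flat_app (bdom (env b'))) in P1.
  rewrite !combine_app in P1 by (rewrite ?flat_length, ?outs_length; auto).
  set (cb := combine (flat (bcod (env b)) []) (outs (b, t, args))) in *.
  assert (Scb : map snd cb = outs (b, t, args)).
  { apply map_snd_combine; rewrite flat_length, outs_length; reflexivity. }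
  assert (Fcb : map fst cb = flat (bcod (env b)) []).
  { apply map_fst_combine; rewrite flat_length, outs_length; reflexivity. }
  assert (Dcb : NoDup cb).
  { apply (NoDup_map_inv snd); rewrite Scb.
    apply FinFun.Injective_map_NoDup; [intros k k' [=]; assumption | apply seq_NoDup]. }
  (* The last box consumes no output of the sought one: its arguments are disjoint from [ns], which
     contains those outputs. The wires [G3] are then spectators of both boxes, and the boxes can be
     interchanged. *)
  assert (Icb : incl cb (combine A ns)).
  { intros [i x] Hx.
    assert (Hx1 : In (i, x) (cb ++ combine A1 ns1)) by (apply in_or_app; auto).
    eapply Permutation_in in Hx1; [|exact P1].
    apply in_app_or in Hx1; destruct Hx1 as [Hx1 | Hx1]; auto; exfalso.
    apply in_combine_r in Hx1; apply (in_map snd) in Hx; rewrite Scb in Hx.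
    apply I1 in Hx; clear - D1 Hx Hx1; simpl in Hx.
    induction args' as [|y args' IH]; simpl in *; [contradiction|].
    inversion D1; subst; destruct Hx1 as [-> | Hx1]; auto.
    apply H1, in_or_app; auto. }
  destruct (incl_Permutation Dcb Icb) as (G3 & P3).
  set (A3 := map fst G3); set (ns3 := map snd G3).
  assert (L3 : length ns3 = length A3) by (unfold A3, ns3; rewrite !length_map; auto).
  assert (E3 : combine A3 ns3 = G3).
  { unfold A3, ns3; clear; induction G3 as [|[i x] G3 IH]; simpl; congruence. }
  destruct (@perm_mor_combine A1 (flat (bdom (env b')) A3) ns1 (args' ++ ns3))
    as [r1 Hr1].
  { lia. }
  { rewrite flat_app, !length_app, flat_length; lia. }
  { rewrite flat_app, combine_app by (rewrite flat_length; auto).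
    rewrite E3; apply (Permutation_app_inv_l cb); rewrite P1, P3, !app_assoc.
    apply Permutation_app_tail, Permutation_app_comm. }
  destruct (@perm_mor_combine (flat (bcod (env b)) A3) A (outs (b, t, args) ++ ns3) ns)
    as [r2 Hr2].
  { rewrite flat_app, !length_app, flat_length, outs_length; lia. }
  { lia. }
  { rewrite flat_app, combine_app by (rewrite flat_length, outs_length; auto).
    rewrite E3; apply Permutation_sym; exact P3. }
  (* By coherence [q] may be replaced by any routing with the same names; this one brings the two
     boxes side by side. *)
  assert (Eq : q = ontail _ r2 ⋅ bswap (bcod (env b)) (bdom (env b')) A3
                   ⋅ ontail _ r1).
  { eapply perm_unique; [exact H4 | | exact D1].
    eapply perm_mor_trans; [apply perm_mor_ontail; [|exact Hr1]|];
      [apply outs_length|].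
    eapply perm_mor_trans; [apply perm_mor_bswap | apply perm_mor_ontail];
      auto using outs_length. }
  exists (flat (bcod (env b')) A3), (outs (b', t', args') ++ ns3),
    ((b', t', args') :: M).
  exists (bswap _ _ _ ⋅ (onhead (bmor (env b')) _ ⋅ (bswap _ _ _
    ⋅ (ontail _ r1 ⋅ g1)))).
  exists (ontail _ r2 ⋅ bswap _ _ _).
  repeat split; auto.
  + eapply RunsPerm; [|apply perm_mor_bswap; auto using outs_length].
    apply RunsBox; [assumption|].
    eapply RunsPerm; [|apply perm_mor_bswap; auto].
    eapply RunsPerm; [exact H1 | apply perm_mor_ontail; auto].
  + rewrite H3; apply perm_swap.
  + eapply perm_mor_trans; [apply perm_mor_bswap | apply perm_mor_ontail];
      auto using outs_length.
  + rewrite Eq, <- !comp_assoc.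
    rewrite (comp_pre (onhead_ontail _ _)), <- comp_assoc; f_equal.
    rewrite (comp_pre (eq_sym (onhead_ontail _ _))), <- comp_assoc.
    rewrite !comp_assoc; do 2 f_equal; symmetry; apply box_interchange.
Qed.

Lemma runs_nil A ns (g : Hom (dl A0) (dl A)) :
  runs ns0 ns [] g -> perm_mor ns0 ns g.
Proof.
intros H; remember [] as N; induction H; try discriminate.
- constructor; assumption.
- eapply perm_mor_trans; eauto.
Qed.

(** The order of execution is irrelevant: [runs_peel] makes the last box of the first run the last
    one of the second run too, induction treats the remaining boxes, and [perm_unique] the final
    permutation. *)
Theorem runs_unique A ns N (f : Hom (dl A0) (dl A)) :
  runs ns0 ns N f -> NoDup N ->
  forall A' ns' N' (g : Hom (dl A0) (dl A')) (p : Hom (dl A) (dl A')),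
  runs ns0 ns' N' g -> Permutation N N' -> perm_mor ns ns' p -> g = p ⋅ f.
Proof.
induction 1 as [E|A A' ns ns' N f q H IH Hq|b t args A ns N f E H IH];
  intros DN A2 ns2 N2 g p Hg HN Hp.
- apply Permutation_nil in HN; subst; rewrite comp_idr.
  eapply perm_unique; [apply runs_nil; eassumption | eassumption |].
  eapply Permutation_NoDup; [eapply perm_mor_names|]; eassumption.
- rewrite comp_assoc; eapply IH; eauto; eapply perm_mor_trans; eassumption.
- assert (DN2 : NoDup N2) by (eapply Permutation_NoDup; eassumption).
  destruct (runs_names Hg D0 V0 DN2) as [Dns2 _].
  destruct (perm_mor_perm Hp) as (P1 & L1 & L2).
  rewrite flat_app, !length_app, flat_length, outs_length in L1.
  edestruct (runs_peel (b := b) (t := t) (args := args) Hg DN2)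
    as (A1 & ns1 & N1 & g1 & q & H1 & H2 & H3 & H4 & ->).
  { eapply Permutation_in; [exact HN | left; reflexivity]. }
  { intros x Hx; eapply Permutation_in; [eapply perm_mor_names; exact Hp|].
    apply in_or_app; left; exact Hx. }
  destruct (perm_mor_perm H4) as (P2 & L3 & _).
  rewrite flat_app, !length_app, flat_length, outs_length in L3.
  destruct (@perm_mor_combine A A1 ns ns1) as [r Hr]; [lia | lia | |].
  { rewrite <- P2, (flat_app _ A), (flat_app _ A1), !combine_app in P1
      by (rewrite flat_length, outs_length; reflexivity).
    apply Permutation_app_inv_l in P1; exact P1. }
  inversion DN; subst.
  rewrite (IH ltac:(assumption) _ _ _ _ (ontail _ r) H1).
  + rewrite <- comp_assoc, (comp_pre (onhead_ontail _ _)), !comp_assoc.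
    do 2 f_equal.
    eapply perm_unique; [|exact Hp | exact Dns2].
    eapply perm_mor_trans; [apply perm_mor_ontail; [apply outs_length | exact Hr]|].
    exact H4.
  + apply (Permutation_cons_inv (a := (b, t, args))); rewrite HN; exact H3.
  + apply perm_mor_ontail; auto.
Qed.

End Unique.

End Wires.

(** * Search for redexes and boolean checks on programs *)

Definition state : Type := list name * list node * nat.

Fixpoint assoc_list (T : Type) (i : nat) (l : list (nat * T)) : option T :=
  match l with
  | [] => None
  | (j, x) :: l => if i =? j then Some x else assoc_list i l
  end.

Fixpoint subst_name (v : nat -> name) (ht : nat -> nat) (x : name) : name :=
  match x with
  | Var i => v i
  | Out k b t args => Out k b (ht t) (map (subst_name v ht) args)
  end.

Definition env_var (l : list (nat * name)) (i : nat) : name :=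
  match assoc_list i l with Some x => x | None => Var i end.

Definition env_tag (l : list (nat * nat)) (t : nat) : nat :=
  match assoc_list t l with Some t' => t' | None => t end.

Definition bind (T : Type) (eqb : T -> T -> bool) (i : nat) (x : T)
  (l : list (nat * T)) : option (list (nat * T)) :=
  match assoc_list i l with
  | Some y => if eqb x y then Some l else None
  | None => Some ((i, x) :: l)
  end.

Definition matching : Type := list (nat * name) * list (nat * nat).

Definition bind_tag (t t' : nat) (m : matching) : option matching :=
  match t with
  | 0 => if t' =? 0 then Some m else None
  | _ => match bind Nat.eqb t t' (snd m) with
         | Some l => Some (fst m, l)
         | None => None
         end
  end.

Fixpoint match_name (p x : name) (m : matching) : option matching :=
  match p with
  | Var i => match bind eqb_name i x (fst m) with
           | Some l => Some (l, snd m)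
           | None => None
           end
  | Out k b t ps =>
      match x with
      | Var _ => None
      | Out k' b' t' xs =>
          if (b =? b') && (k =? k') then
            match bind_tag t t' m with
            | None => None
            | Some m =>
                (fix go ps xs m :=
                   match ps, xs with
                   | [], [] => Some m
                   | p :: ps, x :: xs =>
                       match match_name p x m with
                       | Some m => go ps xs m
                       | None => None
                       end
                   | _, _ => None
                   end) ps xs m
            end
          else None
      end
  end.

Fixpoint match_names (ps xs : list name) (m : matching) : option matching :=
  match ps, xs with
  | [], [] => Some m
  | p :: ps, x :: xs =>
      match match_name p x m with
      | Some m => match_names ps xs m
      | None => None
      end
  | _, _ => None
  end.

Definition match_node (p n : node) (m : matching) : option matching :=
  let '(b, t, ps) := p in
  let '(b', t', xs) := n in
  if b =? b' then
    match bind_tag t t' m with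
    | Some m => match_names ps xs m
    | None => None
    end
  else None.

(** Backtracking over all assignments, which may even hit one node twice; a wrong candidate is
    harmless because [rewrite_at] checks it. *)
Fixpoint match_nodes (ps ns : list node) (m : matching) : list matching :=
  match ps with
  | [] => [m]
  | p :: ps =>
      flat_map (fun n => match match_node p n m with
                         | Some m => match_nodes ps ns m
                         | None => []
                         end) ns
  end.

Fixpoint index_of (x : name) (l : list name) (i : nat) : option nat :=
  match l with
  | [] => None
  | y :: l => if eqb_name x y then Some i else index_of x l (S i)
  end.

Fixpoint abstract_name (l : list name) (i : nat) (x : name) : name :=
  match index_of x l i with
  | Some j => Var j
  | None => match x with
            | Var j => Var j
            | Out k b t args => Out k b t (map (abstract_name l i) args)
            end
  end.

Fixpoint pull (i : nat) (x : name) (G : list (nat * name)) :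
  option (list (nat * name)) :=
  match G with
  | [] => None
  | (j, y) :: G =>
      if (i =? j) && eqb_name x y then Some G
      else match pull i x G with
           | Some R => Some ((j, y) :: R)
           | None => None
           end
  end.

Fixpoint pulls (L G : list (nat * name)) : option (list (nat * name)) :=
  match L with
  | [] => Some G
  | (i, x) :: L =>
      match pull i x G with
      | Some G => pulls L G
      | None => None
      end
  end.

Fixpoint remove_node (n : node) (N : list node) : option (list node) :=
  match N with
  | [] => None
  | m :: N => if eqb_node n m then Some N
              else match remove_node n N with
                   | Some R => Some (m :: R)
                   | None => None
                   end
  end.

Fixpoint perm_nodes (M N : list node) : bool :=
  match M with
  | [] => match N with [] => true | _ => false end
  | n :: M => match remove_node n N with
              | Some N => perm_nodes M N
              | None => false
              end
  end.

Fixpoint nodup_nodes (N : list node) : bool :=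
  match N with
  | [] => true
  | n :: N => negb (existsb (eqb_node n) N) && nodup_nodes N
  end.

Lemma pull_perm i x G R : pull i x G = Some R -> Permutation G ((i, x) :: R).
Proof.
revert R; induction G as [|[j y] G IH]; simpl; intros R H; [discriminate|].
destruct ((i =? j) && eqb_name x y) eqn:E.
- apply andb_true_iff in E; destruct E as [E1 E2].
  apply Nat.eqb_eq in E1; apply eqb_nameP in E2; injection H as <-; subst; reflexivity.
- destruct (pull i x G) as [R'|]; [|discriminate]; injection H as <-.
  eapply perm_trans; [apply perm_skip, IH; reflexivity | apply perm_swap].
Qed.

Lemma pulls_perm L G R : pulls L G = Some R -> Permutation G (L ++ R).
Proof.
revert G; induction L as [|[i x] L IH]; simpl; intros G H.
- injection H as <-; reflexivity.
- destruct (pull i x G) as [G'|] eqn:E; [|discriminate].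
  apply pull_perm in E; rewrite E; apply perm_skip, IH; exact H.
Qed.

Lemma remove_node_perm n N R : remove_node n N = Some R -> Permutation N (n :: R).
Proof.
revert R; induction N as [|m N IH]; simpl; intros R H; [discriminate|].
destruct (eqb_node n m) eqn:E.
- apply eqb_nodeP in E; injection H as <-; subst; reflexivity.
- destruct (remove_node n N) as [R'|]; [|discriminate]; injection H as <-.
  eapply perm_trans; [apply perm_skip, IH; reflexivity | apply perm_swap].
Qed.

Lemma perm_nodesP M N : perm_nodes M N = true -> Permutation M N.
Proof.
revert N; induction M as [|n M IH]; simpl; intros N H.
- destruct N; [reflexivity | discriminate].
- destruct (remove_node n N) as [R|] eqn:E; [|discriminate].
  apply remove_node_perm in E; rewrite E; apply perm_skip, IH; exact H.
Qed.

Lemma nodup_nodesP N : nodup_nodes N = true -> NoDup N.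
Proof.
induction N as [|n N IH]; simpl; intros H; constructor;
  apply andb_true_iff in H; destruct H as [H1 H2]; auto.
intros HI; apply negb_true_iff in H1; apply diff_true_false; rewrite <- H1; symmetry.
apply existsb_exists; exists n; split; [exact HI | apply eqb_nodeP; reflexivity].
Qed.

(** * Certified rewriting of string diagrams *)

Section Expr.
Context (C : SymMonCategory) (atom : nat -> C) (env : nat -> box atom).
Notation dob := (dob atom).
Notation dl := (dl atom).

Inductive expr : ob -> ob -> Type :=
| EId a : expr a a
| EComp a b c (g : expr b c) (f : expr a b) : expr a c
| ETens a a' b b' (f : expr a a') (g : expr b b') : expr (OT a b) (OT a' b')
| EAssoc a b c : expr (OT (OT a b) c) (OT a (OT b c))
| EAssocInv a b c : expr (OT a (OT b c)) (OT (OT a b) c)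
| ELunit a : expr (OT OI a) a
| ELunitInv a : expr a (OT OI a)
| ERunit a : expr (OT a OI) a
| ERunitInv a : expr a (OT a OI)
| ESym a b : expr (OT a b) (OT b a)
| EBox b : expr (bdom (env b)) (bcod (env b)).

Fixpoint den a b (e : expr a b) : Hom (dob a) (dob b) :=
  match e with
  | EId a => idm (dob a)
  | EComp g f => den g ⋅ den f
  | ETens f g => den f ⊗ den g
  | EAssoc a b c => assoc (dob a) (dob b) (dob c)
  | EAssocInv a b c => assoc_inv (dob a) (dob b) (dob c)
  | ELunit a => lunit (dob a)
  | ELunitInv a => lunit_inv (dob a)
  | ERunit a => runit (dob a)
  | ERunitInv a => runit_inv (dob a)
  | ESym a b => sym (dob a) (dob b)
  | EBox b => bmor (env b)
  end.

(** The counter [c] numbers the boxes without inputs. All calls start it at 1, because 0 is the tag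
    of boxes with inputs. [tag] translates the numbers: to the tags of a matched redex, or to fresh
    ones beyond those in use. *)
Fixpoint run (tag : nat -> nat) a b (e : expr a b) (c : nat) (xs : list name) : state :=
  match e with
  | EComp g f =>
      let '(ys, N, c) := run tag f c xs in
      let '(zs, M, c) := run tag g c ys in
      (zs, M ++ N, c)
  | @ETens a _ _ _ f g =>
      let '(ys, N, c) := run tag f c (firstn (width a) xs) in
      let '(zs, M, c) := run tag g c (skipn (width a) xs) in
      (ys ++ zs, M ++ N, c)
  | ESym a b => (skipn (width a) xs ++ firstn (width a) xs, [], c)
  | EBox b =>
      let n := (b, match xs with [] => tag c | _ => 0 end, xs) in
      (outs env n, [n], match xs with [] => S c | _ => c end)
  | _ => (xs, [], c)
  end.

Lemma runs_id A ns : length ns = length A -> runs env ns ns [] (idm (dl A)).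
Proof. apply RunsId. Qed.

Lemma runs_perm A A' ns ns' (p : Hom (dl A) (dl A')) :
  perm_mor ns ns' p -> runs env ns ns' [] p.
Proof.
intros H; rewrite <- (comp_idr p); eapply RunsPerm; [apply runs_id | exact H].
apply perm_mor_perm in H; apply H.
Qed.

Lemma app_flat_length o (xs ns : list name) A :
  length xs = width o -> length ns = length A ->
  length (xs ++ ns) = length (flat o A).
Proof. rewrite flat_app, !length_app, flat_length; lia. Qed.

(** The spectators [A] are quantified because in the tensor case each factor runs beside the wires
    of the other. *)
Lemma run_sound tag a b (e : expr a b) c xs ys N c' :
  run tag e c xs = (ys, N, c') -> length xs = width a ->
  length ys = width b /\
  forall A ns, length ns = length A ->
    runs env (A0 := flat a A) (A := flat b A) (xs ++ ns) (ys ++ ns) N (onhead (den e) A).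
Proof.
revert c xs ys N c'; induction e as [a|a b d g IHg f IHf|a a' b b' f IHf g IHg
  |a b d|a b d|a|a|a|a|a b|b]; simpl; intros c xs ys N c' H E;
  try (injection H as <- <- _; split; [simpl; lia|]; intros A ns L;
    rewrite ?onhead_id, ?onhead_assoc, ?onhead_assoc_inv, ?onhead_lunit,
      ?onhead_lunit_inv, ?onhead_runit, ?onhead_runit_inv;
    apply runs_id, app_flat_length; simpl; lia).
- destruct (run tag f c xs) as [[zs Nf] cf] eqn:Ef.
  destruct (run tag g cf zs) as [[us Ng] cg] eqn:Eg.
  injection H as <- <- _.
  destruct (IHf _ _ _ _ _ Ef E) as [Lz Hf], (IHg _ _ _ _ _ Eg Lz) as [Lu Hg].
  split; [exact Lu|]; intros A ns L; rewrite onhead_comp.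
  eapply runs_comp; auto.
- destruct (split_width E) as (l1 & l2 & -> & E1 & E2).
  rewrite <- E1, firstn_app, skipn_app, Nat.sub_diag, firstn_all, skipn_all in H.
  rewrite app_nil_r in H; simpl in H.
  destruct (run tag f c l1) as [[zs Nf] cf] eqn:Ef.
  destruct (run tag g cf l2) as [[us Ng] cg] eqn:Eg.
  injection H as <- <- _.
  destruct (IHf _ _ _ _ _ Ef E1) as [Lz Hf], (IHg _ _ _ _ _ Eg E2) as [Lu Hg].
  split; [rewrite length_app; lia|]; intros A ns L.
  rewrite onhead_tens, ontail_onhead, <- !app_assoc.
  eapply runs_comp; [apply Hf, app_flat_length; auto|].
  (* Behind the wires of [f], running [g] means running it in front between two block swaps, which
     contribute no nodes. *)
  rewrite <- (app_nil_r Ng); change (Ng ++ []) with ([] ++ (Ng ++ [])).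
  rewrite <- (comp_assoc (bswap _ _ _ _)).
  eapply runs_comp; [|apply runs_perm, perm_mor_bswap; auto].
  eapply runs_comp; [apply runs_perm, perm_mor_bswap; auto|].
  apply Hg, app_flat_length; auto.
- destruct (split_width E) as (l1 & l2 & -> & E1 & E2).
  rewrite <- E1, firstn_app, skipn_app, Nat.sub_diag, firstn_all, skipn_all in H.
  rewrite app_nil_r in H; simpl in H; injection H as <- <- _.
  split; [rewrite length_app; lia|]; intros A ns L.
  rewrite onhead_sym, <- !app_assoc; apply runs_perm, perm_mor_bswap; auto.
- injection H as <- <- _; split; [apply outs_length|]; intros A ns L.
  rewrite <- (comp_idr (onhead _ _)).
  apply RunsBox; [exact E | apply runs_id, app_flat_length; auto].
Qed.

Definition exec1 (n : node) (G : list (nat * name)) : option (list (nat * name)) :=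
  let '(b, t, args) := n in
  if length args =? width (bdom (env b)) then
    match pulls (combine (flat (bdom (env b)) []) args) G with
    | Some R => Some (combine (flat (bcod (env b)) []) (outs env n) ++ R)
    | None => None
    end
  else None.

Fixpoint exec (N : list node) (G : list (nat * name)) : option (list (nat * name)) :=
  match N with
  | [] => Some G
  | n :: N => match exec N G with Some G => exec1 n G | None => None end
  end.

Lemma combine_fst_snd (S T : Type) (l : list (S * T)) :
  combine (map fst l) (map snd l) = l.
Proof. induction l as [|[x y] l IH]; simpl; congruence. Qed.

Lemma pulls_mor o xs G R :
  length xs = width o -> pulls (combine (flat o []) xs) G = Some R ->
  exists p : Hom (dl (map fst G)) (dl (flat o (map fst R))),
    perm_mor (map snd G) (xs ++ map snd R) p.
Proof.
intros E H; apply perm_mor_combine.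
- rewrite !length_map; reflexivity.
- apply app_flat_length; rewrite ?length_map; auto.
- rewrite flat_app, combine_app by (rewrite flat_length; auto).
  rewrite !combine_fst_snd; apply pulls_perm; exact H.
Qed.

Lemma exec_sound N G G' :
  exec N G = Some G' ->
  exists g : Hom (dl (map fst G)) (dl (map fst G')),
    runs env (map snd G) (map snd G') N g.
Proof.
revert G'; induction N as [|n N IH]; simpl; intros G' H.
- injection H as <-; exists (idm _); apply runs_id; rewrite !length_map; reflexivity.
- destruct (exec N G) as [G1|]; [|discriminate].
  destruct (IH _ eq_refl) as [g Hg]; destruct n as [[b t] args]; simpl in H.
  destruct (Nat.eqb_spec (length args) (width (bdom (env b)))) as [E|]; [|discriminate].
  destruct (pulls _ G1) as [R|] eqn:ER; [|discriminate]; injection H as <-.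
  destruct (pulls_mor E ER) as [p Hp].
  rewrite !map_app, map_fst_combine, map_snd_combine, <- flat_app
    by (rewrite flat_length; symmetry; apply outs_length).
  eexists; exact (RunsBox t E (RunsPerm Hg Hp)).
Qed.

Record rule := Rule {
  rdom : ob;
  rcod : ob;
  rlhs : expr rdom rcod;
  rrhs : expr rdom rcod
}.
Definition valid (r : rule) : Prop := den (rlhs r) = den (rrhs r).

(** The match [m] singles out the nodes of the left-hand side.  The remaining nodes are
    split into those that do not depend on it and those that do; in the latter its
    outputs are replaced by fresh variables, so that the same program can be run after
    either side of the rule.  Nothing about the search is trusted: the two runs are
    checked against the given state, and [runs_unique] identifies the morphisms. *)
Definition rewrite_at (A0 A : list nat) (r : rule) (m : matching) (st : state) :
  option state :=
  let '(ns, N, c) := st in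
  let n0 := length A0 in
  let ss := map (env_var (fst m)) (seq 0 (width (rdom r))) in
  let '(t1, N1, _) := run (env_tag (snd m)) (rlhs r) 1 ss in
  let '(t2, N2, c2) := run (Nat.add c) (rrhs r) 1 ss in
  let ys := map Var (seq n0 (width (rcod r))) in
  let abs := abstract_name t1 n0 in
  let others := filter (fun n => negb (existsb (eqb_node n) N1)) N in
  let before := filter (fun n => eqb_node n (map_node abs id n)) others in
  let after := map (map_node abs id)
    (filter (fun n => negb (eqb_node n (map_node abs id n))) others) in
  let h1 := subst_name (env_var (combine (seq n0 (width (rcod r))) t1)) id in
  let h2 := subst_name (env_var (combine (seq n0 (width (rcod r))) t2)) id in
  match exec before (combine A0 (map Var (seq 0 n0))) with
  | None => None
  | Some G1 =>
  match pulls (combine (flat (rdom r) []) ss) G1 with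
  | None => None
  | Some R =>
  match exec after (combine (flat (rcod r) []) ys ++ R) with
  | None => None
  | Some G2 =>
  match pulls (combine A (map abs ns)) G2 with
  | Some [] =>
      if eqb_list eqb_name (map h1 (ys ++ map snd R)) (t1 ++ map snd R)
         && (eqb_list eqb_name (map h2 (ys ++ map snd R)) (t2 ++ map snd R)
         && (eqb_list eqb_name (map h1 (map abs ns)) ns
         && (perm_nodes (map (map_node h1 id) after ++ N1 ++ before) N
         && nodup_nodes N)))
      then Some (map h2 (map abs ns), map (map_node h2 id) after ++ N2 ++ before, c + c2)
      else None
  | _ => None
  end end end end.

Definition invariant A0 A (f : Hom (dl A0) (dl A)) (st : state) : Prop :=
  let '(ns, N, c) := st in runs env (map Var (seq 0 (length A0))) ns N f.

Lemma start_NoDup n : NoDup (map Var (seq 0 n)).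
Proof. apply FinFun.Injective_map_NoDup; [intros i j [=]; auto | apply seq_NoDup]. Qed.

Lemma start_Var n x : In x (map Var (seq 0 n)) -> exists i, x = Var i.
Proof. intros H; apply in_map_iff in H; destruct H as (i & <- & _); eauto. Qed.

Lemma rewrite_at_sound A0 A r m st st' (f : Hom (dl A0) (dl A)) :
  valid r -> invariant f st -> rewrite_at A0 A r m st = Some st' -> invariant f st'.
Proof.
intros Hr Hf; destruct st as [[ns N] c]; unfold rewrite_at, invariant in *.
set (n0 := length A0) in *.
set (ss := map (env_var (fst m)) (seq 0 (width (rdom r)))).
assert (Lss : length ss = width (rdom r))
  by (unfold ss; rewrite length_map, length_seq; auto).
destruct (run _ (rlhs r) 1 ss) as [[t1 N1] c1] eqn:E1.
destruct (run _ (rrhs r) 1 ss) as [[t2 N2] c2] eqn:E2.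
destruct (run_sound E1 Lss) as [L1 R1], (run_sound E2 Lss) as [L2 R2].
set (ys := map Var (seq n0 (width (rcod r)))).
assert (Lys : length ys = width (rcod r))
  by (unfold ys; rewrite length_map, length_seq; auto).
set (abs := abstract_name t1 n0).
set (before := filter _ (filter _ N)).
set (after := map _ (filter _ (filter _ N))).
set (h1 := subst_name (env_var (combine (seq n0 (width (rcod r))) t1)) id).
set (h2 := subst_name (env_var (combine (seq n0 (width (rcod r))) t2)) id).
destruct (exec before _) as [G1|] eqn:EB; [|discriminate].
destruct (pulls _ G1) as [R|] eqn:EG; [|discriminate].
destruct (exec after _) as [G2|] eqn:EA; [|discriminate].
destruct (pulls (combine A (map abs ns)) G2) as [[|]|] eqn:EP; try discriminate.
match goal with |- (if ?b then _ else _) = _ -> _ => destruct b eqn:EC; [|discriminate] end.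
intros [= <-].
rewrite !andb_true_iff in EC; destruct EC as (C1 & C2 & C3 & C4 & C5).
assert (EQN : forall x y, eqb_name x y = true -> x = y) by (intros x y; apply eqb_nameP).
apply (eqb_listP EQN) in C1, C2, C3; apply perm_nodesP in C4; apply nodup_nodesP in C5.
apply exec_sound in EB, EA.
rewrite map_fst_combine, map_snd_combine in EB
  by (rewrite length_map, length_seq; reflexivity).
rewrite !map_app, map_fst_combine, map_snd_combine, <- flat_app in EA
  by (rewrite flat_length; auto).
destruct EB as [g1 H1], EA as [g2 H2].
destruct (pulls_mor Lss EG) as [p1 P1].
destruct (@perm_mor_combine C atom (map fst G2) A (map snd G2) (map abs ns)) as [p2 P2].
{ rewrite !length_map; reflexivity. }
{ rewrite length_map; exact (runs_length Hf). }
{ rewrite combine_fst_snd; apply pulls_perm in EP; rewrite app_nil_r in EP; exact EP. }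
assert (H3 := RunsPerm H2 P2).
assert (LR : length (map snd R) = length (map fst R)) by (rewrite !length_map; reflexivity).
(* With [h1] putting the outputs of the redex back for the fresh variables, this composite runs
   exactly the nodes of the given state, so it will be identified with [f]. [HR] is the same context
   with the other side of the rule. *)
assert (HL : runs env (map Var (seq 0 n0)) ns
  (map (map_node h1 id) after ++ N1 ++ before)
  (p2 ⋅ g2 ⋅ (onhead (den (rlhs r)) (map fst R) ⋅ (p1 ⋅ g1)))).
{ eapply runs_comp;
    [eapply runs_comp; [eapply RunsPerm; eassumption | apply R1; exact LR]|].
  rewrite <- C1; rewrite <- C3 at 1.
  apply runs_map; [reflexivity | exact H3]. }
assert (HR : runs env (map Var (seq 0 n0)) (map h2 (map abs ns))
  (map (map_node h2 id) after ++ N2 ++ before)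
  (p2 ⋅ g2 ⋅ (onhead (den (rrhs r)) (map fst R) ⋅ (p1 ⋅ g1)))).
{ eapply runs_comp;
    [eapply runs_comp; [eapply RunsPerm; eassumption | apply R2; exact LR]|].
  rewrite <- C2.
  apply runs_map; [reflexivity | exact H3]. }
rewrite <- Hr in HR.
replace f with (p2 ⋅ g2 ⋅ (onhead (den (rlhs r)) (map fst R) ⋅ (p1 ⋅ g1))); [exact HR|].
rewrite <- (comp_idl f).
eapply runs_unique;
  [apply start_NoDup | apply start_Var | exact Hf | exact C5 | exact HL | |].
- apply Permutation_sym; exact C4.
- constructor; exact (runs_length Hf).
Qed.

Definition rule_matches (r : rule) (N : list node) : list matching :=
  let '(_, P, _) := run id (rlhs r) 1 (map Var (seq 0 (width (rdom r)))) in
  match_nodes P N ([], []).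

Fixpoint rewrite_nth A0 A r (ms : list matching) (k : nat) (st : state) : option state :=
  match ms with
  | [] => None
  | m :: ms =>
      match rewrite_at A0 A r m st, k with
      | Some st', 0 => Some st'
      | Some _, S k => rewrite_nth A0 A r ms k st
      | None, _ => rewrite_nth A0 A r ms k st
      end
  end.

Definition rewrite_rule A0 A r k (st : state) : option state :=
  rewrite_nth A0 A r (rule_matches r (snd (fst st))) k st.

Fixpoint rewrite_first A0 A (rs : list rule) (st : state) : option state :=
  match rs with
  | [] => None
  | r :: rs => match rewrite_rule A0 A r 0 st with
               | Some st => Some st
               | None => rewrite_first A0 A rs st
               end
  end.

Fixpoint simplify (fuel : nat) A0 A (rs : list rule) (st : state) : state :=
  match fuel with
  | 0 => st
  | S fuel => match rewrite_first A0 A rs st with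
              | Some st => simplify fuel A0 A rs st
              | None => st
              end
  end.

Inductive step := Simp (rs : list rule) | Rewrite (r : rule) (k : nat).

Definition valid_step (s : step) : Prop :=
  match s with Simp rs => Forall valid rs | Rewrite r _ => valid r end.

(** A failing rewrite keeps the state and 200 only bounds the number of rewrites: every intermediate
    state denotes the same morphism, so no termination order is required. *)
Definition run_step A0 A (st : state) (s : step) : state :=
  match s with
  | Simp rs => simplify 200 A0 A rs st
  | Rewrite r k => match rewrite_rule A0 A r k st with Some st => st | None => st end
  end.

Lemma rewrite_rule_sound A0 A r k st st' (f : Hom (dl A0) (dl A)) :
  valid r -> invariant f st -> rewrite_rule A0 A r k st = Some st' -> invariant f st'.
Proof.
intros Hr Hf; unfold rewrite_rule; generalize (rule_matches r (snd (fst st))) as ms.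
intros ms; revert k; induction ms as [|m ms IH]; simpl; intros k; [discriminate|].
destruct (rewrite_at A0 A r m st) as [s|] eqn:E.
- destruct k; [intros [= <-]; eapply rewrite_at_sound; eassumption | apply IH].
- apply IH.
Qed.

Lemma run_step_sound A0 A s st (f : Hom (dl A0) (dl A)) :
  valid_step s -> invariant f st -> invariant f (run_step A0 A st s).
Proof.
destruct s as [rs|r k]; unfold run_step; intros Hs.
- generalize 200 as fuel; intros fuel; revert st; induction fuel as [|fuel IH]; simpl; auto.
  intros st Hf; destruct (rewrite_first A0 A rs st) as [st'|] eqn:E; auto.
  apply IH; clear IH; revert E; simpl in Hs; induction Hs as [|r rs Hr Hs IHs]; simpl;
    [discriminate|].
  destruct (rewrite_rule A0 A r 0 st) as [s|] eqn:E; auto.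
  intros [= <-]; eapply rewrite_rule_sound; eassumption.
- intros Hf; destruct (rewrite_rule A0 A r k st) eqn:E; auto.
  eapply rewrite_rule_sound; eassumption.
Qed.

Fixpoint tags_of (x : name) : list nat :=
  match x with
  | Var _ => []
  | Out _ _ t args =>
      match args with
      | [] => [t]
      | _ => flat_map tags_of args
      end
  end.

(** Two scripts may create units in different orders, so tags are renumbered by first occurrence;
    [nodup] keeps last occurrences, hence the double reversal. Soundness needs no injectivity, as
    [runs_map] allows any map of tags. *)
Definition normalize_tags (st : state) : list name * list node :=
  let '(ns, N, _) := st in
  let ts := rev (nodup Nat.eq_dec (rev
    (flat_map tags_of ns ++
     flat_map (fun n : node =>
       let '(b, t, args) := n in flat_map tags_of args ++ [t]) N))) in
  let ht t := if t =? 0 then 0 else env_tag (combine ts (seq 1 (length ts))) t in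
  let h := subst_name Var ht in
  (map h ns, map (map_node h ht) N).

Definition normal_form a b (e : expr a b) (s : list step) : state :=
  fold_left (run_step (flat a []) (flat b [])) s
    (run id e 1 (map Var (seq 0 (width a)))).

Definition same_diagram a b (e1 e2 : expr a b) (s1 s2 : list step) : bool :=
  let '(ns1, N1) := normalize_tags (normal_form e1 s1) in
  let '(ns2, N2) := normalize_tags (normal_form e2 s2) in
  eqb_list eqb_name ns1 ns2 && (perm_nodes N1 N2 && nodup_nodes N1).

Lemma normal_form_sound a b (e : expr a b) s :
  Forall valid_step s -> invariant (onhead (den e) []) (normal_form e s).
Proof.
intros Hs; unfold normal_form.
assert (H : invariant (onhead (den e) []) (run id e 1 (map Var (seq 0 (width a))))).
{ destruct (run id e 1 _) as [[ns N] c] eqn:E; unfold invariant; rewrite flat_length.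
  destruct (run_sound E) as [_ H]; [rewrite length_map, length_seq; reflexivity|].
  specialize (H [] [] eq_refl); rewrite !app_nil_r in H; exact H. }
revert H; generalize (run id e 1 (map Var (seq 0 (width a)))).
induction Hs as [|x s Hx Hs IH]; simpl; auto.
intros st H; apply IH, run_step_sound; assumption.
Qed.

Lemma normalize_tags_sound A0 A (f : Hom (dl A0) (dl A)) st :
  invariant f st ->
  runs env (map Var (seq 0 (length A0)))
    (fst (normalize_tags st)) (snd (normalize_tags st)) f.
Proof.
destruct st as [[ns N] c]; unfold invariant, normalize_tags; cbv zeta.
match goal with |- context [map_node (subst_name Var ?t)] => set (ht := t) end.
intros H; apply (runs_map (h := subst_name Var ht) (ht := ht)) in H; [|reflexivity].
rewrite map_map in H; exact H.
Qed.

Lemma onhead_inj a b (f g : Hom (dob a) (dob b)) : onhead f [] = onhead g [] -> f = g.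
Proof.
intros H; apply rfaithful; unfold onhead in H.
apply (mono_iso (bwdK atom b [])), (epi_iso (bwdK atom a [])); exact H.
Qed.

Theorem same_diagram_sound a b (e1 e2 : expr a b) s1 s2 :
  Forall valid_step s1 -> Forall valid_step s2 ->
  same_diagram e1 e2 s1 s2 = true -> den e1 = den e2.
Proof.
intros V1 V2 H; apply onhead_inj.
apply normal_form_sound with (e := e1) in V1; apply normal_form_sound with (e := e2) in V2.
apply normalize_tags_sound in V1, V2; unfold same_diagram in H.
destruct (normalize_tags (normal_form e1 s1)) as [ns1 N1].
destruct (normalize_tags (normal_form e2 s2)) as [ns2 N2]; simpl in *.
rewrite !andb_true_iff in H; destruct H as (C1 & C2 & C3).
apply (eqb_listP (fun x y => proj1 (eqb_nameP x y))) in C1; subst ns2.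
apply perm_nodesP in C2; apply nodup_nodesP in C3.
rewrite <- (comp_idl (onhead (den e1) [])); symmetry.
eapply runs_unique;
  [apply start_NoDup | apply start_Var | exact V1 | exact C3 | exact V2 | exact C2 |].
constructor; exact (runs_length V1).
Qed.

End Expr.

(** * Reflection: from equations in the category to programs *)

Record law (C : SymMonCategory) := Law {
  ldom : C;
  lcod : C;
  llhs : Hom ldom lcod;
  lrhs : Hom ldom lcod;
  lproof : llhs = lrhs
}.

(** [At l k] rewrites the [k]-th redex of [l]. *)
Inductive script_step (C : SymMonCategory) :=
| Simps (ls : list (law C))
| At (l : law C) (k : nat).

Definition flip (C : SymMonCategory) (l : law C) : law C := Law (eq_sym (lproof l)).

Ltac tuple_add x l :=
  lazymatch l with
  | tt => constr:((x, tt))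
  | (x, _) => l
  | (?y, ?r) => let r' := tuple_add x r in constr:((y, r'))
  end.

Ltac tuple_index x l :=
  lazymatch l with
  | (x, _) => constr:(0)
  | (_, ?r) => let n := tuple_index x r in constr:(S n)
  end.

Ltac add_atoms o l :=
  lazymatch o with
  | munit _ => l
  | @tens _ ?a ?b => let l := add_atoms a l in add_atoms b l
  | _ => tuple_add o l
  end.

Ltac unfold_midswap f := eval cbv beta delta [midswap] in f.

Ltac collect f acc :=
  lazymatch f with
  | @comp _ _ _ _ ?g ?f => let acc := collect f acc in collect g acc
  | @tensm _ _ _ _ _ ?f ?g => let acc := collect f acc in collect g acc
  | @idm _ ?X => add_ob X acc
  | @assoc _ ?X ?Y ?Z =>
      let acc := add_ob X acc in let acc := add_ob Y acc in add_ob Z acc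
  | @assoc_inv _ ?X ?Y ?Z =>
      let acc := add_ob X acc in let acc := add_ob Y acc in add_ob Z acc
  | @lunit _ ?X => add_ob X acc
  | @lunit_inv _ ?X => add_ob X acc
  | @runit _ ?X => add_ob X acc
  | @runit_inv _ ?X => add_ob X acc
  | @sym _ ?X ?Y => let acc := add_ob X acc in add_ob Y acc
  | @midswap _ _ _ _ _ => let f := unfold_midswap f in collect f acc
  | _ =>
      lazymatch type of f with
      | @Hom _ ?X ?Y =>
          let acc := add_ob X acc in
          let acc := add_ob Y acc in
          lazymatch acc with (?la, ?lb) => let lb := tuple_add f lb in constr:((la, lb)) end
      end
  end
with add_ob X acc :=
  lazymatch acc with (?la, ?lb) => let la := add_atoms X la in constr:((la, lb)) end.

Ltac collect_law l acc :=
  lazymatch l with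
  | flip ?l => collect_law l acc
  | @Law _ _ _ ?f ?g _ => let acc := collect f acc in collect g acc
  | _ => let l := eval hnf in l in collect_law l acc
  end.

Ltac collect_laws ls acc :=
  let ls := eval hnf in ls in
  lazymatch ls with
  | nil => acc
  | cons ?l ?ls => let acc := collect_law l acc in collect_laws ls acc
  end.

Ltac collect_script s acc :=
  let s := eval hnf in s in
  lazymatch s with
  | nil => acc
  | cons (Simps ?ls) ?s => let acc := collect_laws ls acc in collect_script s acc
  | cons (At ?l _) ?s => let acc := collect_law l acc in collect_script s acc
  end.

Ltac reify_ob o la :=
  lazymatch o with
  | munit _ => constr:(OI)
  | @tens _ ?a ?b => let a := reify_ob a la in let b := reify_ob b la in constr:(OT a b)
  | _ => let n := tuple_index o la in constr:(OA n)
  end.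

Ltac atom_list C la :=
  lazymatch la with
  | tt => constr:(@nil (Ob (mcat (smcat C))))
  | (?x, ?la) => let l := atom_list C la in constr:(@cons (Ob (mcat (smcat C))) x l)
  end.

Ltac box_list C atom la lb :=
  lazymatch lb with
  | tt => constr:(@nil (@box C atom))
  | (?f, ?lb) =>
      let l := box_list C atom la lb in
      lazymatch type of f with
      | @Hom _ ?X ?Y =>
          let X := reify_ob X la in
          let Y := reify_ob Y la in
          constr:(@cons (@box C atom) (@Box C atom X Y f) l)
      end
  end.

Ltac reify C atom env la lb f :=
  let ob o := reify_ob o la in
  let rec go f :=
    lazymatch f with
    | @comp _ ?X ?Y ?Z ?g ?f =>
        let X := ob X in let Y := ob Y in let Z := ob Z in
        let g := go g in let f := go f in constr:(@EComp C atom env X Y Z g f)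
    | @tensm _ ?X ?X' ?Y ?Y' ?f ?g =>
        let X := ob X in let Y := ob Y in let X' := ob X' in let Y' := ob Y' in
        let g := go g in let f := go f in constr:(@ETens C atom env X X' Y Y' f g)
    | @idm _ ?X => let X := ob X in constr:(@EId C atom env X)
    | @assoc _ ?X ?Y ?Z =>
        let X := ob X in let Y := ob Y in let Z := ob Z in
        constr:(@EAssoc C atom env X Y Z)
    | @assoc_inv _ ?X ?Y ?Z =>
        let X := ob X in let Y := ob Y in let Z := ob Z in
        constr:(@EAssocInv C atom env X Y Z)
    | @lunit _ ?X => let X := ob X in constr:(@ELunit C atom env X)
    | @lunit_inv _ ?X => let X := ob X in constr:(@ELunitInv C atom env X)
    | @runit _ ?X => let X := ob X in constr:(@ERunit C atom env X)
    | @runit_inv _ ?X => let X := ob X in constr:(@ERunitInv C atom env X)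
    | @sym _ ?X ?Y => let X := ob X in let Y := ob Y in constr:(@ESym C atom env X Y)
    | @midswap _ _ _ _ _ => let f := unfold_midswap f in go f
    | _ => let n := tuple_index f lb in constr:(@EBox C atom env n)
    end in
  go f.

Ltac reify_law C atom env la lb l :=
  lazymatch l with
  | flip ?l =>
      let r := reify_law C atom env la lb l in
      lazymatch r with (@Rule _ _ _ ?X ?Y ?f ?g, ?pf) =>
        constr:((@Rule C atom env X Y g f, eq_sym pf))
      end
  | @Law _ ?X ?Y ?f ?g ?pf =>
      let X := reify_ob X la in
      let Y := reify_ob Y la in
      let f := reify C atom env la lb f in
      let g := reify C atom env la lb g in
      constr:((@Rule C atom env X Y f g, pf))
  | _ => let l := eval hnf in l in reify_law C atom env la lb l
  end.

Ltac reify_laws C atom env la lb ls :=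
  let ls := eval hnf in ls in
  lazymatch ls with
  | nil => constr:((@nil (rule env), Forall_nil (@valid C atom env)))
  | cons ?l ?ls =>
      let l := reify_law C atom env la lb l in
      let ls := reify_laws C atom env la lb ls in
      lazymatch l with (?r, ?pf) =>
      lazymatch ls with (?rs, ?pfs) =>
        constr:((@cons (rule env) r rs, @Forall_cons _ (@valid C atom env) r rs pf pfs))
      end end
  end.

Ltac reify_script C atom env la lb s :=
  let s := eval hnf in s in
  lazymatch s with
  | nil => constr:((@nil (step env), Forall_nil (@valid_step C atom env)))
  | cons ?x ?s =>
      let ss := reify_script C atom env la lb s in
      lazymatch ss with (?ss, ?pss) =>
      lazymatch x with
      | Simps ?ls =>
          let rs := reify_laws C atom env la lb ls in
          lazymatch rs with (?rs, ?prs) =>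
            constr:((@cons (step env) (Simp rs) ss,
              @Forall_cons _ (@valid_step C atom env) (Simp rs) ss prs pss))
          end
      | At ?l ?k =>
          let r := reify_law C atom env la lb l in
          lazymatch r with (?r, ?pr) =>
            constr:((@cons (step env) (Rewrite r k) ss,
              @Forall_cons _ (@valid_step C atom env) (Rewrite r k) ss pr pss))
          end
      end end
  end.

Ltac diagram_with s1 s2 final :=
  lazymatch goal with
  | |- @eq (@Hom (mcat (smcat ?C)) ?X ?Y) ?f ?g =>
      let acc := collect f constr:((tt, tt)) in
      let acc := collect g acc in
      let s1 := constr:(s1 : list (script_step C)) in
      let s2 := constr:(s2 : list (script_step C)) in
      let acc := collect_script s1 acc in
      let acc := collect_script s2 acc in
      lazymatch acc with (?la, ?lb) =>
        let atoms := atom_list C la in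
        let atom := fresh "atom" in
        pose (atom := fun n : nat => nth n atoms (munit C) : Ob (mcat (smcat C)));
        let bs := box_list C atom la lb in
        let env := fresh "env" in
        pose (env := fun n : nat => nth n bs (@Box C atom OI OI (idm (munit C))));
        let X := reify_ob X la in
        let Y := reify_ob Y la in
        let f := reify C atom env la lb f in
        let g := reify C atom env la lb g in
        let s1 := reify_script C atom env la lb s1 in
        let s2 := reify_script C atom env la lb s2 in
        lazymatch s1 with (?s1, ?p1) =>
        lazymatch s2 with (?s2, ?p2) =>
          final C atom env X Y f g s1 s2 p1 p2
        end end
      end
  end.

(** The reified sides evaluate to the goal by conversion, so only the boolean check is left to
    [vm_compute]. *)
Ltac diagram_prove C atom env X Y f g s1 s2 p1 p2 :=
  refine (@same_diagram_sound C atom env X Y f g s1 s2 p1 p2 _);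
  vm_compute; reflexivity.

(** [s1] rewrites the left side and [s2] the right one; a single script is used for both. *)
Tactic Notation "diagram" uconstr(s1) uconstr(s2) := diagram_with s1 s2 diagram_prove.

Ltac diagram_prove_both C atom env X Y f g s1 s2 p1 p2 :=
  refine (@same_diagram_sound C atom env X Y f g s1 s1 p1 p1 _);
  vm_compute; reflexivity.

Tactic Notation "diagram" uconstr(s) := diagram_with s uconstr:(nil) diagram_prove_both.

(** * Hopf algebra axioms as oriented rewrite rules *)

Section HopfLaws.
Context (C : SymMonCategory).

Definition coassoc_law (H : Bialgebra C) : law C := Law (coalg_coassoc (bialg_coalgebra H)).
Definition counitl_law (H : Bialgebra C) : law C := Law (coalg_counitl (bialg_coalgebra H)).
Definition counitr_law (H : Bialgebra C) : law C := Law (coalg_counitr (bialg_coalgebra H)).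

(** In the normal form comultiplications come first, nested to the right, and multiplications last;
    [antipode_laws] puts the antipodes in between. Laws that erase boxes stand early, because the
    first applicable law is taken. *)
Definition bialgebra_laws (H : Bialgebra C) : list (law C) :=
  [ Law (counit_unt H); Law (alg_unitl (bialg_algebra H));
    Law (alg_unitr (bialg_algebra H));
    counitl_law H; counitr_law H;
    Law (comul_unt H); Law (counit_mul H); Law (comul_mul H);
    coassoc_law H ].

Definition antipode_laws (H : Bialgebra C) (S : Hom H H) (SA : is_algebra_antihom S)
  (SC : is_coalgebra_antihom S) : list (law C) :=
  [ Law (antihom_unt SA); Law (antihom_counit SC); Law (antihom_mul SA);
    Law (antihom_comul SC) ].

Definition hopf_laws (H : HopfAlgebra C) : list (law C) :=
  bialgebra_laws H ++ antipode_laws (SL_algebra H) (SL_coalgebra H)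
  ++ antipode_laws (SR_algebra H) (SR_coalgebra H).

End HopfLaws.

(** * The smash product *)

Section Cancel.
Context (C : SymMonCategory) (H : HopfAlgebra C).

(** Once comultiplications are nested to the right, the factors of S(x1) x2 in the presence of x3
    come from different boxes, and the antipode axiom no longer matches. *)
Lemma SL_antipode3 :
  (mul H ⊗ idm H) ⋅ ((SL H ⊗ idm H) ⊗ idm H) ⋅ assoc_inv H H H
    ⋅ (idm H ⊗ comul H) ⋅ comul H
  = (unt H ⊗ idm H) ⋅ lunit_inv H.
Proof.
diagram [At (flip (coassoc_law H)) 0;
  Simps [Law (SL_antipode H); counitl_law H]]
  [].
Qed.

Lemma SR_antipode3 :
  (mul H ⊗ idm H) ⋅ ((idm H ⊗ SR H) ⊗ idm H) ⋅ assoc_inv H H H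
    ⋅ (idm H ⊗ comul H) ⋅ comul H
  = (unt H ⊗ idm H) ⋅ lunit_inv H.
Proof.
diagram [At (flip (coassoc_law H)) 0;
  Simps [Law (SR_antipode H); counitl_law H]]
  [].
Qed.

Definition cancel_laws : list (law C) :=
  [Law (SL_antipode H); Law (SR_antipode H); Law SL_antipode3; Law SR_antipode3].

End Cancel.

Section SymAct.
Context (C : SymMonCategory) (B X : HopfAlgebra C).

Definition comul_symmetric (f : Hom (B ⊗ X) X) : Prop :=
  (idm B ⊗ f) ⋅ assoc B B X ⋅ (comul B ⊗ idm X)
  = (idm B ⊗ f) ⋅ assoc B B X ⋅ ((sym B B ⋅ comul B) ⊗ idm X).

(** Symmetry of the first two of three legs, needed because right nesting draws them from different
    comultiplications. *)
Lemma comul_symmetric3 (f : Hom (B ⊗ X) X) :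
  comul_symmetric f ->
  (idm B ⊗ (f ⊗ idm B)) ⋅ (idm B ⊗ (assoc_inv B X B ⋅ (idm B ⊗ sym B X) ⋅ assoc B B X))
    ⋅ assoc B (B ⊗ B) X ⋅ (((idm B ⊗ comul B) ⋅ comul B) ⊗ idm X)
  = (idm B ⊗ (f ⊗ idm B)) ⋅ (idm B ⊗ (assoc_inv B X B ⋅ (idm B ⊗ sym B X) ⋅ assoc B B X))
    ⋅ assoc B (B ⊗ B) X
    ⋅ ((assoc B B B ⋅ (sym B B ⊗ idm B) ⋅ assoc_inv B B B
         ⋅ (idm B ⊗ comul B) ⋅ comul B) ⊗ idm X).
Proof.
intros E.
diagram [At (flip (coassoc_law B)) 0;
  At (Law E) 0; Simps [coassoc_law B]]
  [].
Qed.

End SymAct.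

Section ActionLaws.
Context (C : SymMonCategory) (B X : HopfAlgebra C) (act : Hom (B ⊗ X) X).
Hypothesis P : is_action act.

Lemma act_symmetric : comul_symmetric act.
Proof.
unfold comul_symmetric; rewrite (act_sym P), tens_compl, !comp_assoc; reflexivity.
Qed.

Lemma act_SL_cancel :
  act ⋅ (SL B ⊗ act) ⋅ assoc B B X ⋅ (comul B ⊗ idm X) = lunit X ⋅ (counit B ⊗ idm X).
Proof.
diagram [Simps [Law (act_mul P); Law (SL_antipode B); Law (act_unt P)]] [].
Qed.

Lemma act_SR_cancel :
  act ⋅ (idm B ⊗ (act ⋅ (SR B ⊗ idm X))) ⋅ assoc B B X ⋅ (comul B ⊗ idm X)
  = lunit X ⋅ (counit B ⊗ idm X).
Proof.
diagram [Simps [Law (act_mul P); Law (SR_antipode B); Law (act_unt P)]] [].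
Qed.

(** A left and a right convolution inverse of [b ↦ b ▷ -] agree. *)
Lemma act_SR_SL : act ⋅ (SR B ⊗ idm X) = act ⋅ (SL B ⊗ idm X).
Proof.
(* The middle term is S_L(b1) ▷ (b2 ▷ (S_R(b3) ▷ x)); cancelling its left or its right pair gives
   the two sides. *)
transitivity (act ⋅ (SL B ⊗ act) ⋅ (idm B ⊗ (idm B ⊗ (act ⋅ (SR B ⊗ idm X))))
  ⋅ (idm B ⊗ (assoc B B X ⋅ (comul B ⊗ idm X))) ⋅ assoc B B X ⋅ (comul B ⊗ idm X)).
- diagram [] [At (flip (coassoc_law B)) 0;
    Simps [Law act_SL_cancel; counitl_law B]].
- diagram [Simps [Law act_SR_cancel; counitr_law B]]
    [].
Qed.

Lemma act_SL_cancel_r :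
  act ⋅ (idm B ⊗ (act ⋅ (SL B ⊗ idm X))) ⋅ assoc B B X ⋅ (comul B ⊗ idm X)
  = lunit X ⋅ (counit B ⊗ idm X).
Proof. rewrite <- act_SR_SL; apply act_SR_cancel. Qed.

(** b2 ⊗ S(b1) ▷ x = b2 ⊗ S(b1) ▷ b3 ▷ S(b4) ▷ x = b3 ⊗ S(b1) ▷ b2 ▷ S(b4) ▷ x
    = b1 ⊗ S(b2) ▷ x. *)
Lemma act_SL_symmetric : comul_symmetric (act ⋅ (SL B ⊗ idm X)).
Proof.
unfold comul_symmetric.
transitivity ((idm B ⊗ (act ⋅ (SL B ⊗ (act ⋅ (idm B ⊗ (act ⋅ (SL B ⊗ idm X)))))))
  ⋅ assoc B B _ ⋅ (sym B B ⊗ idm _) ⋅ assoc_inv B B _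
  ⋅ (idm B ⊗ (idm B ⊗ (assoc B B X ⋅ (comul B ⊗ idm X))))
  ⋅ (idm B ⊗ (assoc B B X ⋅ (comul B ⊗ idm X))) ⋅ assoc B B X ⋅ (comul B ⊗ idm X)).
- symmetry.
  diagram [At (flip (coassoc_law B)) 0; At (Law act_symmetric) 0; Simps [coassoc_law B];
     At (flip (coassoc_law B)) 1; Simps [Law act_SL_cancel; counitl_law B]]
    [].
- diagram [Simps [Law act_SL_cancel_r; counitr_law B]]
    [].
Qed.

(** The axiom on S_R with its acting antipode changed to S_L. Unlike S_L, the antipode S_R is not
    assumed to commute with ▷, so S_R(b ▷ x) can only be removed in this combination. *)
Lemma act_SL_SR_cancel :
  act ⋅ (SL B ⊗ (SR X ⋅ act)) ⋅ assoc B B X ⋅ (comul B ⊗ idm X)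
  = lunit X ⋅ (counit B ⊗ SR X).
Proof.
rewrite <- (act_SR P).
diagram [Simps [flip (Law act_SR_SL)]] [].
Qed.

(** S_L reverses the two legs of b. Used from left to right, the equation collects two actions into
    one and makes a product in [X] accessible. *)
Lemma act_SL_on_mul :
  mul X ⋅ (act ⊗ act) ⋅ ((SL B ⊗ idm X) ⊗ (SL B ⊗ idm X)) ⋅ midswap B B X X
    ⋅ ((sym B B ⋅ comul B) ⊗ idm (X ⊗ X))
  = act ⋅ (SL B ⊗ mul X).
Proof.
diagram [] [Simps [Law (act_on_mul P); Law (antihom_comul (SL_coalgebra B))]].
Qed.

End ActionLaws.

Section Semidirect.
Context (C : SymMonCategory) (B X : HopfAlgebra C) (act : Hom (B ⊗ X) X).
Hypothesis P : is_action act.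

(** Read off from (κ(x) e(b)) (κ(y) e(c)) by exchanging the two inner factors. *)
Definition sd_mul : Hom ((X ⊗ B) ⊗ (X ⊗ B)) (X ⊗ B) :=
  (mul X ⊗ mul B) ⋅ (((idm X ⊗ act) ⋅ assoc X B X) ⊗ idm (B ⊗ B))
  ⋅ midswap (X ⊗ B) B X B
  ⋅ ((assoc_inv X B B ⋅ (idm X ⊗ comul B)) ⊗ idm (X ⊗ B)).

Definition sd_unt : Hom (munit C) (X ⊗ B) := (unt X ⊗ unt B) ⋅ lunit_inv (munit C).

Definition sd_comul : Hom (X ⊗ B) ((X ⊗ B) ⊗ (X ⊗ B)) :=
  midswap X X B B ⋅ (comul X ⊗ comul B).

Definition sd_counit : Hom (X ⊗ B) (munit C) := lunit (munit C) ⋅ (counit X ⊗ counit B).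

Definition sd_antipode (SX : Hom X X) (SB : Hom B B) : Hom (X ⊗ B) (X ⊗ B) :=
  (act ⊗ idm B) ⋅ assoc_inv B X B ⋅ (idm B ⊗ sym B X) ⋅ assoc B B X
  ⋅ (comul B ⊗ idm X) ⋅ (SB ⊗ SX) ⋅ sym X B.

(** The direction of each law is the direction of simplification; [act_symmetric] has
    none and is applied by hand. *)
Definition act_laws : list (law C) :=
  [ Law (act_unt P); Law (act_on_unt P); Law (act_counit P); Law (act_comul P);
    flip (Law (act_mul P)); Law (act_on_mul P); flip (Law (act_SL P)); Law (act_SR_SL P) ].

Definition sd_laws : list (law C) := hopf_laws X ++ hopf_laws B ++ act_laws.

Definition act_swap := Law (act_symmetric P).
Definition act_swap3 := Law (comul_symmetric3 (act_symmetric P)).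
Definition act_SL_swap := Law (act_SL_symmetric P).
Definition act_SL_swap3 := Law (comul_symmetric3 (act_SL_symmetric P)).

Lemma sd_algebra : is_algebra sd_mul sd_unt.
Proof.
split; unfold sd_mul, sd_unt.
- diagram [Simps sd_laws] [].
- diagram [Simps sd_laws] [].
Qed.

Lemma sd_coalgebra : is_coalgebra sd_comul sd_counit.
Proof.
split; unfold sd_comul, sd_counit.
- diagram [Simps sd_laws].
- diagram [Simps sd_laws] [].
- diagram [Simps sd_laws] [].
Qed.

(** Apart from the factors x1 and x2, the left side has b1 ▷ y1, b3 c1, b2 ▷ y2, b4 c2 and the right
    side b1 ▷ y1, b2 c1, b3 ▷ y2, b4 c2. The symmetry of the action exchanges the two middle
    legs. *)
Lemma sd_comul_mul : sd_comul ⋅ sd_mul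
  = (sd_mul ⊗ sd_mul) ⋅ midswap (X ⊗ B) (X ⊗ B) (X ⊗ B) (X ⊗ B) ⋅ (sd_comul ⊗ sd_comul).
Proof.
unfold sd_comul, sd_mul.
diagram [Simps sd_laws] [Simps sd_laws; At act_swap3 0].
Qed.

Lemma sd_comul_unt : sd_comul ⋅ sd_unt = (sd_unt ⊗ sd_unt) ⋅ lunit_inv (munit C).
Proof. unfold sd_comul, sd_unt; diagram [Simps sd_laws] []. Qed.

Lemma sd_counit_mul : sd_counit ⋅ sd_mul = lunit (munit C) ⋅ (sd_counit ⊗ sd_counit).
Proof. unfold sd_counit, sd_mul; diagram [Simps sd_laws] []. Qed.

Lemma sd_counit_unt : sd_counit ⋅ sd_unt = idm (munit C).
Proof. unfold sd_counit, sd_unt; diagram [Simps sd_laws] []. Qed.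

Definition sd_cancel_laws : list (law C) :=
  sd_laws ++ cancel_laws X ++ cancel_laws B ++ [Law (act_SL_cancel_r P)].

(** For S((x ⊗ b)(y ⊗ 1)) the simplified left side contains
      S(b4) ▷ (b1 ▷ S y),  S(b3) ▷ S x,  S(b2),
    and the symmetries permute this to S(b1) ▷ (b2 ▷ S y), S(b4) ▷ S x, S(b3). *)
Lemma sd_SL_mul :
  sd_antipode (SL X) (SL B) ⋅ sd_mul
  = sd_mul ⋅ sym (X ⊗ B) (X ⊗ B)
    ⋅ (sd_antipode (SL X) (SL B) ⊗ sd_antipode (SL X) (SL B)).
Proof.
unfold sd_antipode, sd_mul.
diagram [Simps sd_laws; At act_SL_swap 1; At act_SL_swap3 1; At (flip act_swap3) 0;
  At (flip (coassoc_law B)) 1;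
  Simps [Law (act_SL_cancel P); counitl_law B]] [Simps sd_laws].
Qed.

(** As for S_L, except that S_R stays outside the inner action: the pair to be cancelled is S_L(b1)
    ▷ S_R(b2 ▷ y). *)
Lemma sd_SR_mul :
  sd_antipode (SR X) (SR B) ⋅ sd_mul
  = sd_mul ⋅ sym (X ⊗ B) (X ⊗ B)
    ⋅ (sd_antipode (SR X) (SR B) ⊗ sd_antipode (SR X) (SR B)).
Proof.
unfold sd_antipode, sd_mul.
diagram [Simps sd_laws; At act_SL_swap 1; At act_SL_swap3 1; At (flip act_swap3) 0;
  At (flip (coassoc_law B)) 1;
  Simps [Law (act_SL_SR_cancel P); counitl_law B]] [Simps sd_laws].
Qed.

(** The sides differ by an exchange of the middle legs b2 and b3, one of which occurs as S(b) and
    the other in S(b) ▷ -. *)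
Lemma sd_SL_comul :
  sd_comul ⋅ sd_antipode (SL X) (SL B)
  = (sd_antipode (SL X) (SL B) ⊗ sd_antipode (SL X) (SL B)) ⋅ sym _ _ ⋅ sd_comul.
Proof.
unfold sd_antipode, sd_comul.
diagram [Simps sd_laws; At act_SL_swap3 0] [Simps sd_laws].
Qed.

Lemma sd_SR_comul :
  sd_comul ⋅ sd_antipode (SR X) (SR B)
  = (sd_antipode (SR X) (SR B) ⊗ sd_antipode (SR X) (SR B)) ⋅ sym _ _ ⋅ sd_comul.
Proof.
unfold sd_antipode, sd_comul.
diagram [Simps sd_laws; At act_SL_swap3 0] [Simps sd_laws].
Qed.

(** The left side is (S(b3) ▷ S x1) (S(b2) ▷ x2) ⊗ S(b1) b4. Collecting the two actions gives S(b2)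
    ▷ (S(x1) x2) ⊗ S(b1) b3, where everything cancels from the inside. *)
Lemma sd_SL_antipode :
  sd_mul ⋅ (sd_antipode (SL X) (SL B) ⊗ idm (X ⊗ B)) ⋅ sd_comul = sd_unt ⋅ sd_counit.
Proof.
unfold sd_antipode, sd_comul, sd_mul, sd_unt, sd_counit.
diagram [Simps sd_laws; At (flip (coassoc_law B)) 0; At (Law (act_SL_on_mul P)) 0;
  (* S(x1) x2 must be cancelled before the full set of laws can distribute the action over this
     product again. *)
  Simps (cancel_laws X); Simps sd_cancel_laws] [].
Qed.

(** The left side is x1 (b1 ▷ (S(b4) ▷ S x2)) ⊗ b2 S(b3). First b2 S(b3) cancels, then the nested
    actions; as [act_SR_SL] is among the laws, the acting antipode has become S_L, whence
    [act_SL_cancel_r]. *)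
Lemma sd_SR_antipode :
  sd_mul ⋅ (idm (X ⊗ B) ⊗ sd_antipode (SR X) (SR B)) ⋅ sd_comul = sd_unt ⋅ sd_counit.
Proof.
unfold sd_antipode, sd_comul, sd_mul, sd_unt, sd_counit.
diagram [Simps sd_cancel_laws] [].
Qed.

Lemma sd_SL_unt : sd_antipode (SL X) (SL B) ⋅ sd_unt = sd_unt.
Proof. unfold sd_antipode, sd_unt; diagram [Simps sd_laws] []. Qed.

Lemma sd_SR_unt : sd_antipode (SR X) (SR B) ⋅ sd_unt = sd_unt.
Proof. unfold sd_antipode, sd_unt; diagram [Simps sd_laws] []. Qed.

Lemma sd_SL_counit : sd_counit ⋅ sd_antipode (SL X) (SL B) = sd_counit.
Proof. unfold sd_antipode, sd_counit; diagram [Simps sd_laws] []. Qed.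

Lemma sd_SR_counit : sd_counit ⋅ sd_antipode (SR X) (SR B) = sd_counit.
Proof. unfold sd_antipode, sd_counit; diagram [Simps sd_laws] []. Qed.

Definition sd_bialgebra : Bialgebra C := {|
  bialg_ob := X ⊗ B;
  mul := sd_mul;
  unt := sd_unt;
  comul := sd_comul;
  counit := sd_counit;
  bialg_algebra := sd_algebra;
  bialg_coalgebra := sd_coalgebra;
  comul_mul := sd_comul_mul;
  comul_unt := sd_comul_unt;
  counit_mul := sd_counit_mul;
  counit_unt := sd_counit_unt
|}.

Definition sd_hopf : HopfAlgebra C := {|
  hopf_bialg := sd_bialgebra;
  SL := sd_antipode (SL X) (SL B) : Hom sd_bialgebra sd_bialgebra;
  SR := sd_antipode (SR X) (SR B) : Hom sd_bialgebra sd_bialgebra;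
  SL_algebra := @Build_is_algebra_antihom _ sd_bialgebra _ sd_SL_mul sd_SL_unt;
  SL_coalgebra := @Build_is_coalgebra_antihom _ sd_bialgebra _ sd_SL_comul sd_SL_counit;
  SR_algebra := @Build_is_algebra_antihom _ sd_bialgebra _ sd_SR_mul sd_SR_unt;
  SR_coalgebra := @Build_is_coalgebra_antihom _ sd_bialgebra _ sd_SR_comul sd_SR_counit;
  SL_antipode := sd_SL_antipode;
  SR_antipode := sd_SR_antipode
|}.

Definition sd_inl : Hom X (X ⊗ B) := (idm X ⊗ unt B) ⋅ runit_inv X.
Definition sd_inr : Hom B (X ⊗ B) := (unt X ⊗ idm B) ⋅ lunit_inv B.
Definition sd_fst : Hom (X ⊗ B) X := runit X ⋅ (idm X ⊗ counit B).
Definition sd_snd : Hom (X ⊗ B) B := lunit B ⋅ (counit X ⊗ idm B).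

Ltac sd_unfold :=
  cbn;
  unfold sd_inl, sd_inr, sd_fst, sd_snd, sd_mul, sd_unt, sd_comul, sd_counit, sd_antipode.

Lemma sd_inl_hom : @is_hopf_hom C X sd_hopf sd_inl.
Proof.
repeat split; sd_unfold; diagram [Simps sd_laws].
Qed.

Lemma sd_inr_hom : @is_hopf_hom C B sd_hopf sd_inr.
Proof.
repeat split; sd_unfold; diagram [Simps sd_laws].
Qed.

Lemma sd_snd_hom : @is_hopf_hom C sd_hopf B sd_snd.
Proof.
repeat split; sd_unfold; diagram [Simps sd_laws].
Qed.

Definition sd_kappa : HopfHom X sd_hopf := Build_HopfHom sd_inl_hom.
Definition sd_alpha : HopfHom sd_hopf B := Build_HopfHom sd_snd_hom.
Definition sd_e : HopfHom B sd_hopf := Build_HopfHom sd_inr_hom.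

Lemma sd_split : is_split_extension sd_kappa sd_alpha sd_e (sd_fst : Hom sd_hopf X).
Proof.
constructor; [..| constructor |]; sd_unfold.
(* (5') and (11') *)
7: diagram [Simps sd_laws; At act_swap 0] [Simps sd_laws].
12: diagram [] [Simps sd_laws; Simps [Law (act_SL_SR_cancel P)]].
all: diagram [Simps sd_laws].
Qed.

End Semidirect.

Definition coalgebra_hom_laws (C : SymMonCategory) (A B : Bialgebra C) (f : Hom A B)
  (Hf : is_coalgebra_hom f) : list (law C) :=
  [ Law (hom_counit Hf); Law (hom_comul Hf) ].

Definition hopf_hom_laws (C : SymMonCategory) (A B : HopfAlgebra C) (f : Hom A B)
  (Hf : is_hopf_hom f) : list (law C) :=
  [ Law (hom_unt (hopf_hom_algebra Hf)); Law (hom_mul (hopf_hom_algebra Hf)) ]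
  ++ coalgebra_hom_laws (hopf_hom_coalgebra Hf)
  ++ [ flip (Law (hopf_hom_SL Hf)); flip (Law (hopf_hom_SR Hf)) ].

(** * The action of a split extension *)

Section FromSplit.
Context (C : SymMonCategory) (X A B : HopfAlgebra C).
Context (kappa : HopfHom X A) (alpha : HopfHom A B) (e : HopfHom B A) (lam : Hom A X).
Hypothesis P : is_split_extension kappa alpha e lam.
(** Keeping the action as a variable with a defining equation lets the reflection treat it as one
    box, which [act_def] folds and unfolds. *)
Context (act : Hom (B ⊗ X) X).
Hypothesis act_def : lam ⋅ mul A ⋅ (e ⊗ kappa) = act.

Definition hom_laws : list (law C) :=
  hopf_laws X ++ hopf_laws A ++ hopf_laws B
  ++ hopf_hom_laws (hopf_homP kappa) ++ hopf_hom_laws (hopf_homP alpha)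
  ++ hopf_hom_laws (hopf_homP e) ++ coalgebra_hom_laws (lam_coalgebra P)
  ++ [ Law (lam_kappa P); Law (alpha_e P); Law (lam_e P); Law (alpha_kappa P);
       Law (se_lam P); Law (lam_unt P); Law act_def ].

(** Apply (3') to the element e(b) κ(x). *)
Lemma se_exchange :
  mul A ⋅ (e ⊗ kappa)
  = mul A ⋅ ((kappa ⋅ act) ⊗ e) ⋅ assoc_inv B X B ⋅ (idm B ⊗ sym B X) ⋅ assoc B B X
    ⋅ (comul B ⊗ idm X).
Proof.
rewrite <- (comp_idl (mul A ⋅ (e ⊗ kappa))), <- (se_decomp P).
diagram [Simps hom_laws].
Qed.

(** These drive a product of values of κ and e to the form κ(x) e(b): brackets open, each e moves
    right past κ, and neighbours merge. Then [project_laws] evaluates λ by discarding the e-part. *)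
Definition factor_laws : list (law C) :=
  [ Law (se_assoc_ke P); flip (Law (se_assoc__ke P)); Law se_exchange;
    flip (Law (hom_mul (hopf_hom_algebra (hopf_homP kappa))));
    flip (Law (hom_mul (hopf_hom_algebra (hopf_homP e)))) ].

Definition project_laws : list (law C) :=
  [ Law (se_lam P); Law (counit_mul B); counitl_law B; counitr_law B ].

(** λ is applied to (e(b) e(c)) κ(x) = e(b) (e(c) κ(x)), an instance of [se_assoc_e_k] with e in the
    middle. *)
Lemma se_act_mul : act ⋅ (idm B ⊗ act) ⋅ assoc B B X = act ⋅ (mul B ⊗ idm X).
Proof.
diagram [] [At (flip (Law act_def)) 0;
  At (Law (hom_mul (hopf_hom_algebra (hopf_homP e)))) 0;
  At (Law (se_assoc_e_k P)) 0; Simps factor_laws; Simps project_laws].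
Qed.

(** The same law with κ in the middle: e(b) (κ(x) κ(y)) = (e(b) κ(x)) κ(y), and b passes the two
    factors one after the other. *)
Lemma se_act_on_mul :
  act ⋅ (idm B ⊗ mul X)
  = mul X ⋅ (act ⊗ act) ⋅ midswap B B X X ⋅ (comul B ⊗ (idm X ⊗ idm X)).
Proof.
diagram [At (flip (Law act_def)) 0;
  At (Law (hom_mul (hopf_hom_algebra (hopf_homP kappa)))) 0;
  At (flip (Law (se_assoc_e_k P))) 0; Simps factor_laws;
  Simps (coassoc_law B :: project_laws)] [].
Qed.

Lemma se_act_sym :
  (idm B ⊗ act) ⋅ assoc B B X ⋅ (comul B ⊗ idm X)
  = (idm B ⊗ act) ⋅ assoc B B X ⋅ (sym B B ⊗ idm X) ⋅ (comul B ⊗ idm X).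
Proof. rewrite <- act_def, !tens_compr; apply (se_sym P). Qed.

Lemma se_act_SR :
  act ⋅ (SR B ⊗ SR X) ⋅ (idm B ⊗ act) ⋅ assoc B B X ⋅ (comul B ⊗ idm X)
  = lunit X ⋅ (counit B ⊗ SR X).
Proof. rewrite (se_SR P), <- act_def, !tens_compr, !comp_assoc; reflexivity. Qed.

Lemma se_action : is_action act.
Proof.
constructor.
- rewrite <- act_def; diagram [Simps hom_laws].
- rewrite <- act_def; diagram [Simps hom_laws].
- apply se_act_sym.
- rewrite <- act_def; diagram [Simps hom_laws].
- diagram [At (flip (Law act_def)) 0; Simps hom_laws] [].
- apply se_act_mul.
- apply se_act_on_mul.
- rewrite <- act_def, !comp_assoc; symmetry; apply (se_SL P).
- apply se_act_SR.
Qed.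

Definition se_join : Hom (X ⊗ B) A := mul A ⋅ (kappa ⊗ e).
Definition se_split : Hom A (X ⊗ B) := (lam ⊗ alpha) ⋅ comul A.

Lemma se_joinK : se_split ⋅ se_join = idm (X ⊗ B).
Proof. unfold se_split, se_join; diagram [Simps hom_laws] []. Qed.

Lemma se_splitK : se_join ⋅ se_split = idm A.
Proof.
rewrite <- (se_decomp P); unfold se_split, se_join.
rewrite <- !comp_assoc, (comp_pre (eq_sym (tensm_comp _ _ _ _))); reflexivity.
Qed.

Lemma se_join_hom : @is_hopf_hom C (sd_hopf se_action) A se_join.
Proof.
repeat split; cbn; unfold se_join, sd_mul, sd_unt, sd_comul, sd_counit, sd_antipode.
- diagram [Simps factor_laws].
- diagram [Simps hom_laws].
- diagram [Simps hom_laws].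
- diagram [Simps hom_laws].
- diagram [Simps [Law (antihom_comul (SL_coalgebra B))]]
    [Simps [Law (antihom_mul (SL_algebra A));
      flip (Law (hopf_hom_SL (hopf_homP kappa))); flip (Law (hopf_hom_SL (hopf_homP e)));
      Law se_exchange; Law (antihom_comul (SL_coalgebra B))]].
- diagram [Simps [Law (antihom_comul (SR_coalgebra B))]]
    [Simps [Law (antihom_mul (SR_algebra A));
      flip (Law (hopf_hom_SR (hopf_homP kappa))); flip (Law (hopf_hom_SR (hopf_homP e)));
      Law se_exchange; Law (antihom_comul (SR_coalgebra B))]].
Qed.

End FromSplit.

Lemma is_hopf_hom_inv (C : SymMonCategory) (A B : HopfAlgebra C)
  (f : Hom A B) (g : Hom B A) :
  g ⋅ f = idm A -> f ⋅ g = idm B -> is_hopf_hom f -> is_hopf_hom g.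
Proof.
intros E E' [[f1 f2] [f3 f4] f5 f6]; repeat split.
- rewrite <- (comp_idr (mul B)), <- tensm_id, <- E', tensm_comp.
  rewrite (comp_assoc (mul B)), <- f1, !comp_assoc, E, comp_idl; reflexivity.
- rewrite <- f2, comp_assoc, E; apply comp_idl.
- rewrite <- (comp_idl (comul A)), <- tensm_id, <- E, tensm_comp.
  rewrite <- (comp_assoc (g ⊗ g)), <- f3, <- !comp_assoc, E', comp_idr; reflexivity.
- rewrite <- f4, <- comp_assoc, E'; apply comp_idr.
- rewrite <- (comp_idr (SL B)), <- E', (comp_assoc (SL B)), <- f5, !comp_assoc, E, comp_idl.
  reflexivity.
- rewrite <- (comp_idr (SR B)), <- E', (comp_assoc (SR B)), <- f6, !comp_assoc, E, comp_idl.
  reflexivity.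
Qed.

(** * The two functors and the comparison isomorphisms *)

Section Functors.
Context (C : SymMonCategory).

Definition act_of_split (E : SplitExtension C) : Action C :=
  Build_Action (se_action (split_extensionP E) eq_refl).

Definition split_of_act (a : Action C) : SplitExtension C :=
  Build_SplitExtension (sd_split (actionP a)).

Definition act_of_split_hom (E E' : SplitExtension C) (f : SplitExtHom E E') :
  ActionHom (act_of_split E) (act_of_split E').
Proof.
refine (@Build_ActionHom C (act_of_split E) (act_of_split E') (sh_g f) (sh_v f) _).
abstract (simpl; diagram [Simps [flip (Law (sh_lambda f));
  Law (hom_mul (hopf_hom_algebra (hopf_homP (sh_p f)))); Law (sh_e f); Law (sh_kappa f)]]).
Defined.

Lemma sd_map_hom (a a' : Action C) (f : ActionHom a a') :
  @is_hopf_hom C (sd_hopf (actionP a)) (sd_hopf (actionP a')) (ah_v f ⊗ ah_g f).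
Proof.
repeat split; cbn; unfold sd_mul, sd_unt, sd_comul, sd_counit, sd_antipode;
  diagram [Simps (Law (ah_comm f) :: hopf_hom_laws (hopf_homP (ah_v f))
    ++ hopf_hom_laws (hopf_homP (ah_g f)))].
Qed.

Definition split_of_act_hom (a a' : Action C) (f : ActionHom a a') :
  SplitExtHom (split_of_act a) (split_of_act a').
Proof.
refine (@Build_SplitExtHom C (split_of_act a) (split_of_act a') (ah_g f) (ah_v f)
  (Build_HopfHom (sd_map_hom f)) _ _ _ _);
  abstract (cbn; unfold sd_inl, sd_inr, sd_fst, sd_snd;
    diagram [Simps (hopf_hom_laws (hopf_homP (ah_v f))
      ++ hopf_hom_laws (hopf_homP (ah_g f)))]).
Defined.

Definition split_to_act : Functor (SplitExt C) (Act C).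
Proof.
refine {| fob := act_of_split : SplitExt C -> Act C; fmap := act_of_split_hom |};
  abstract (intros; apply action_hom_eq; reflexivity).
Defined.

Definition act_to_split : Functor (Act C) (SplitExt C).
Proof.
refine {| fob := split_of_act : Act C -> SplitExt C; fmap := split_of_act_hom |}.
- abstract (intros; apply split_ext_hom_eq; [reflexivity .. | apply tensm_id]).
- abstract (intros; apply split_ext_hom_eq; [reflexivity .. | apply tensm_comp]).
Defined.

Section Comparison.
Variable (E : SplitExtension C).
Let P := split_extensionP E.

Definition comparison_hom : HopfHom (se_A (split_of_act (act_of_split E))) (se_A E) :=
  Build_HopfHom (se_join_hom P eq_refl).

Definition comparison_inv_hom : HopfHom (se_A E) (se_A (split_of_act (act_of_split E))) :=
  Build_HopfHom (@is_hopf_hom_inv C (sd_hopf (se_action P eq_refl)) (se_A E) _ _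
    (se_joinK P eq_refl) (se_splitK P) (se_join_hom P eq_refl)).

Definition comparison : SplitExtHom (split_of_act (act_of_split E)) E.
Proof.
refine (@Build_SplitExtHom C (split_of_act (act_of_split E)) E (hopf_id _) (hopf_id _)
  comparison_hom _ _ _ _).
all: abstract (cbn; unfold se_join, sd_inl, sd_inr, sd_fst, sd_snd;
  diagram [Simps (hom_laws P eq_refl)]).
Defined.

Definition comparison_inv : SplitExtHom E (split_of_act (act_of_split E)).
Proof.
refine (@Build_SplitExtHom C E (split_of_act (act_of_split E)) (hopf_id _) (hopf_id _)
  comparison_inv_hom _ _ _ _).
all: abstract (cbn; unfold se_split, sd_inl, sd_inr, sd_fst, sd_snd;
  diagram [Simps (hom_laws P eq_refl)]).
Defined.

End Comparison.

Lemma comparison_natural (E E' : SplitExtension C) (f : SplitExtHom E E') :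
  se_join (se_kappa E') (se_e E') ⋅ (sh_v f ⊗ sh_g f)
  = sh_p f ⋅ se_join (se_kappa E) (se_e E).
Proof.
unfold se_join.
rewrite comp_assoc, (hom_mul (hopf_hom_algebra (hopf_homP (sh_p f)))), <- !comp_assoc.
rewrite <- !tensm_comp, sh_kappa, sh_e; reflexivity.
Qed.

Definition split_natiso :
  NatIso (comp_functor act_to_split split_to_act) (id_functor (SplitExt C)).
Proof.
refine (@Build_NatIso _ _ (comp_functor act_to_split split_to_act) (id_functor (SplitExt C))
  comparison comparison_inv _ _ _).
- intros E E' f; apply split_ext_hom_eq; simpl.
  + rewrite comp_idl, comp_idr; reflexivity.
  + rewrite comp_idl, comp_idr; reflexivity.
  + apply comparison_natural.
- intros E; apply split_ext_hom_eq; simpl.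
  + apply comp_idl.
  + apply comp_idl.
  + apply (se_joinK (split_extensionP E) eq_refl).
- intros E; apply split_ext_hom_eq; simpl.
  + apply comp_idl.
  + apply comp_idl.
  + apply (se_splitK (split_extensionP E)).
Defined.

(** In the smash product (1 ⊗ b)(x ⊗ 1) = (b1 ▷ x) ⊗ b2, and the projection to [X] applies the
    counit to b2. The Hopf algebras are unchanged by conversion, so identities serve as components
    of the isomorphism. *)
Lemma act_of_split_of_act (a : Action C) :
  action_map (act_of_split (split_of_act a)) = action_map a.
Proof.
cbn; unfold sd_inl, sd_inr, sd_fst, sd_mul.
diagram [Simps (sd_laws (actionP a))].
Qed.

Definition act_counit_hom (a : Action C) : ActionHom (act_of_split (split_of_act a)) a.
Proof.
refine (@Build_ActionHom C (act_of_split (split_of_act a)) a (hopf_id _) (hopf_id _) _).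
rewrite act_of_split_of_act; simpl; rewrite tensm_id, comp_idl, comp_idr; reflexivity.
Defined.

Definition act_unit_hom (a : Action C) : ActionHom a (act_of_split (split_of_act a)).
Proof.
refine (@Build_ActionHom C a (act_of_split (split_of_act a)) (hopf_id _) (hopf_id _) _).
rewrite act_of_split_of_act; simpl; rewrite tensm_id, comp_idl, comp_idr; reflexivity.
Defined.

Definition act_natiso :
  NatIso (comp_functor split_to_act act_to_split) (id_functor (Act C)).
Proof.
refine (@Build_NatIso _ _ (comp_functor split_to_act act_to_split) (id_functor (Act C))
  act_counit_hom act_unit_hom _ _ _); intros; apply action_hom_eq; simpl;
  rewrite ?comp_idl, ?comp_idr; reflexivity.
Defined.

End Functors.

Theorem theorem4p9 (C : SymMonCategory) :
  equivalent_categories (SplitExt C) (Act C).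
Proof.
exists (split_to_act C), (act_to_split C); split; constructor.
- apply split_natiso.
- apply act_natiso.
Qed.
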